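(* Let $k\ge 2$ and let $\alpha,\beta,\gamma,\delta\in\mathbb{C}$ be such that $q:=1+\beta\gamma-\alpha\delta\neq 0$ and $1+\beta\gamma[n]\neq 0$ for every positive integer $n$. Let $H$ be the discrete Hamiltonian and $G$ the propagation operator on $F(L)$ (both defined in the context). Then $$HG=G\Bigl(\sum_{i=1}^{k}\widehat{X}_{i}\Bigr)$$ as operators on $F(L)$. Therefore, if $f\in F(L)$ is an eigenfunction of $\sum_{i=1}^{k}\widehat{X}_i$ with eigenvalue $\lambda$, i.e. $\sum_{i=1}^k\widehat{X}_i f=\lambda f$, then $G(f)$ is an eigenfunction of $H$ with the same eigenvalue, i.e. $H\,G(f)=\lambda\, G(f)$.
   Context: Root system notation. $V=\bigoplus_{i=1}^k\mathbb{R}v_i$ is Euclidean space with orthonormal basis $\{v_i\}$; $\{\epsilon_i\}$ is the dual basis of $V^*$; $\alpha_{ij}=\epsilon_i-\epsilon_j$; $a_i=\alpha_{i,i+1}$ and $a_i^\vee=v_i-v_{i+1}$ for $1\le i<k$. $W$ is the group generated by the reflections $s_i(v)=v-a_i(v)a_i^\vee$, with length function $\ell$. $\overline{C_+}=\{v\in V\mid a_i(v)\ge 0,\ 1\le i<k\}$. For $v\in V$, $w_v\in W$ is the unique shortest element with $w_v v\in\overline{C_+}$. $L=\bigoplus_{i=1}^k\mathbb{Z}v_i$, and $F(L)$ is the space of functions $L\to\mathbb{C}$. $[n]=(1-q^n)/(1-q)=1+q+\cdots+q^{n-1}$ for $n\ge 0$ ($[0]=0$), $[n]!=\prod_{a=1}^n[a]$,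 $[0]!=1$. Operators on $F(L)$. $(\widehat{X}_if)(x)=f(x-v_i)$ for $1\le i\le k$. For $1\le i<k$, $\widehat{T}_i$ is defined by $(\widehat{T}_if)(x)=(e^x\check{T}_i,f)$, where $(\cdot,\cdot):\mathbb{C}[L]\times F(L)\to\mathbb{C}$ is the bilinear pairing with $(e^x,f)=f(x)$ and $\check{T}_i$ acts (from the right) on the group algebra $\mathbb{C}[L]=\mathbb{C}[e^{\pm v_1},\dots,e^{\pm v_k}]$ by $$P\check{T}_i=P.s_i+\frac{(\alpha e^{v_i}+\beta)(\gamma e^{v_{i+1}}+\delta)}{e^{v_i}-e^{v_{i+1}}}(P-P.s_i),\qquad e^x.w:=e^{w^{-1}(x)}.$$ The $\widehat{T}_i$ satisfy the braid relations; for $w\in W$ with reduced expression $w=s_{i_1}\cdots s_{i_r}$, $\widehat{T}_w:=\widehat{T}_{i_1}\cdots\widehat{T}_{i_r}$ (independent of the reduced expression). Propagation operator: $G:F(L)\to F(L)$, $G(f)(x):=(\widehat{T}_{w_x}f)(w_xx)$. Discrete Hamiltonian. For $x\in L$ let $d_i^+(x)=\#\{p\mid i<p\le k,\ \alpha_{ip}(x)=0\}$, $d_i^-(x)=\#\{p\mid 1\le p<i,\ \alpha_{pi}(x)=0\}$, and let $\delta_{j_1,\dots,j_r}(x)=1$ if $\epsilon_{j_1}(x)=\cdots=\epsilon_{j_r}(x)$ and $0$ otherwise ($\delta_j\equiv1$). Then $$H=-\alpha\gamma\sum_{j=1}^k\frac{[d_j^+]}{1+\beta\gamma[d_j^+]}+\sum_{r=1}^k(-\beta\delta)^{r-1}[r-1]!\,q^{-r(r-1)/2}\sum_{1\le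 j_1<\cdots<j_r\le k}\frac{q^{\sum_{p=1}^rd_{j_p}^-}\,\delta_{j_1,\dots,j_r}}{\prod_{p=0}^{r-1}(1+\beta\gamma[d_{j_1}^++d_{j_1}^--p])}\prod_{p=1}^r\widehat{X}_{j_p},$$ where functions on $L$ act by multiplication (after the shifts are applied), and terms at points where $\delta_{j_1,\dots,j_r}(x)=0$ are $0$. *)

(* Defs.v *)
From HB Require Import structures.
From mathcomp Require Import all_boot all_order all_algebra finmap.
From mathcomp Require Import classical_sets reals complex monalg.

Set Implicit Arguments.
Unset Strict Implicit.
Unset Printing Implicit Defensive.

Import GRing.Theory Num.Theory.

Local Open Scope ring_scope.

(* Indices are 0-based: coordinates are indexed by 'I_k and the simple roots
   by 'I_k.-1; [lft i] and [rgt i] are the positions i and i+1 in 'I_k. *)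
Definition lft (k : nat) (i : 'I_k.-1) : 'I_k := widen_ord (leq_pred k) i.

Lemma rgt_subproof (k : nat) (i : 'I_k.-1) : (i.+1 < k)%N.
Proof. by rewrite -ltn_predRL. Qed.

Definition rgt (k : nat) (i : 'I_k.-1) : 'I_k := Ordinal (rgt_subproof i).

Section RootSystem.
Variable k : nat.

(* The lattice L, in the orthonormal basis v_1, ..., v_k.  The reflections
   preserve L, which spans V, so W is recorded through its action on L, i.e.
   by matrices in that basis. *)
Definition lattice := 'cV[int]_k.

Definition vbasis_elt (i : 'I_k) : lattice := delta_mx i 0.
Definition dual_elt (i : 'I_k) : 'rV[int]_k := delta_mx 0 i.

Definition pair_form (xi : 'rV[int]_k) (x : lattice) : int := (xi *m x) 0 0.

Definition alpha_root (i j : 'I_k) : 'rV[int]_k := dual_elt i - dual_elt j.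

Definition simple_root (i : 'I_k.-1) : 'rV[int]_k := alpha_root (lft i) (rgt i).

Definition simple_coroot (i : 'I_k.-1) : lattice :=
  vbasis_elt (lft i) - vbasis_elt (rgt i).

Definition simple_refl (i : 'I_k.-1) : 'M[int]_k :=
  1%:M - simple_coroot i *m simple_root i.

Lemma alpha_rootE (i j : 'I_k) (x : lattice) :
  pair_form (alpha_root i j) x = x i 0 - x j 0.
Proof. by rewrite /pair_form /alpha_root mulmxBl -!rowE !mxE. Qed.

Lemma simple_reflE (i : 'I_k.-1) (x : lattice) :
  simple_refl i *m x = x - pair_form (simple_root i) x *: simple_coroot i.
Proof.
rewrite /simple_refl mulmxBl mul1mx -mulmxA.
by rewrite [simple_root i *m x]mx11_scalar mul_mx_scalar.
Qed.

Definition word_prod (s : seq 'I_k.-1) : 'M[int]_k :=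
  foldr (fun i w => simple_refl i *m w) 1%:M s.

(* The generators are involutions, so the group they generate consists of
   their products. *)
Definition weyl_group : set 'M[int]_k :=
  [set w | exists s, word_prod s = w]%classic.

Definition is_length (w : 'M[int]_k) (n : nat) : Prop :=
  (exists2 s, word_prod s = w & size s = n) /\
  (forall s, word_prod s = w -> (n <= size s)%N).

(* [xget] returns its first argument only when the set is empty. *)
Definition weyl_length (w : 'M[int]_k) : nat :=
  xget 0%N [set n | is_length w n]%classic.

Definition reduced_expression (w : 'M[int]_k) (s : seq 'I_k.-1) : Prop :=
  word_prod s = w /\ size s = weyl_length w.

Definition in_closed_chamber (x : lattice) : Prop :=
  forall i : 'I_k.-1, 0 <= pair_form (simple_root i) x.

Definition is_sorting_elt (x : lattice) (w : 'M[int]_k) : Prop :=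
  [/\ weyl_group w, in_closed_chamber (w *m x) &
      forall w', weyl_group w' -> in_closed_chamber (w' *m x) ->
        (weyl_length w <= weyl_length w')%N].

(* w_x *)
Definition sorting_elt (x : lattice) : 'M[int]_k :=
  xget 1%:M [set w | is_sorting_elt x w]%classic.

End RootSystem.

Section GroupAlgebra.
Variables (C : fieldType) (k : nat).
Local Notation L := (lattice k).

(* C[L] as finitely supported functions on L; [monalg] provides its product
   only for monoids without nontrivial units, hence [lmul]. *)
Definition group_alg := {malg C[L]}.

Definition lexp (x : L) : group_alg := << x >>.

Definition lconst (c : C) : group_alg := << c *g (0 : L) >>.

Definition lmul (P Q : group_alg) : group_alg :=
  \sum_(x <- msupp P) \sum_(y <- msupp Q) << P@_x * Q@_y *g x + y >>.

(* The exact quotient A / B; it is unique when B != 0, C[L] being a domain. *)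
Definition ldiv (A B : group_alg) : group_alg :=
  xget 0 [set Q | lmul B Q = A]%classic.

(* e^x.w = e^{w^-1 x} *)
Definition lact (P : group_alg) (w : 'M[int]_k) : group_alg :=
  \sum_(x <- msupp P) << P@_x *g invmx w *m x >>.

Definition fun_space := L -> C.

Definition lpairing (P : group_alg) (f : fun_space) : C :=
  \sum_(x <- msupp P) P@_x * f x.

End GroupAlgebra.

Section Operators.
Variables (C : fieldType) (k : nat) (alpha beta gamma delta : C).
Local Notation L := (lattice k).
Local Notation F := (fun_space C k).

Definition T_check (i : 'I_k.-1) (P : group_alg C k) : group_alg C k :=
  let ei := lexp C (vbasis_elt (lft i)) in
  let ei1 := lexp C (vbasis_elt (rgt i)) in
  let Ps := lact P (simple_refl i) in
  Ps + lmul (lmul (lmul (lconst k alpha) ei + lconst k beta)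
                  (lmul (lconst k gamma) ei1 + lconst k delta))
            (ldiv (P - Ps) (ei - ei1)).

Definition T_hat (i : 'I_k.-1) (f : F) : F :=
  fun x => lpairing (T_check i (lexp C x)) f.

(* By the braid relations, the reduced expression chosen by [xget] is
   immaterial. *)
Definition T_hat_elt (w : 'M[int]_k) : F -> F :=
  foldr (fun i T => T_hat i \o T) id
    (xget [::] [set s | reduced_expression w s]%classic).

Definition X_hat (i : 'I_k) (f : F) : F := fun x => f (x - vbasis_elt i).

Definition X_hat_sum (f : F) : F := fun x => \sum_(i < k) X_hat i f x.

Definition propagation (f : F) : F :=
  fun x => T_hat_elt (sorting_elt x) f (sorting_elt x *m x).

Definition hecke_q : C := 1 + beta * gamma - alpha * delta.

(* [n] = (1 - q^n) / (1 - q), written so as to allow q = 1 *)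
Definition qint (n : nat) : C := \sum_(a < n) hecke_q ^+ a.

Definition qfact (n : nat) : C := \prod_(1 <= a < n.+1) qint a.

Definition d_plus (x : L) (i : 'I_k) : nat :=
  #|[set p : 'I_k | (i < p)%N & pair_form (alpha_root i p) x == 0]|.

Definition d_minus (x : L) (i : 'I_k) : nat :=
  #|[set p : 'I_k | (p < i)%N & pair_form (alpha_root p i) x == 0]|.

(* delta_{j_1,...,j_r}(x) = 1 *)
Definition same_coords (x : L) (J : seq 'I_k) : bool :=
  constant [seq pair_form (dual_elt j) x | j <- J].

(* The coefficient of the (r+1)-fold product of the X_hat's.  When the
   coordinates agree, d^+_{j_1} + d^-_{j_1} >= r, so the natural number
   subtraction is never truncated. *)
Definition ham_coef (r : nat) (J : r.+1.-tuple 'I_k) (x : L) : C :=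
  if same_coords x J then
    hecke_q ^+ (\sum_(j <- J) d_minus x j)%N /
    \prod_(p < r.+1)
      (1 + beta * gamma * qint (d_plus x (thead J) + d_minus x (thead J) - p)%N)
  else 0.

Definition ham_const (x : L) : C :=
  - (alpha * gamma) *
    \sum_(j < k) qint (d_plus x j) / (1 + beta * gamma * qint (d_plus x j)).

(* The outer index is shifted by one: the term at r sums over
   j_1 < ... < j_{r+1}. *)
Definition hamiltonian (f : F) : F := fun x =>
  ham_const x * f x +
  \sum_(r < k)
    (- (beta * delta)) ^+ r * qfact r / hecke_q ^+ (r.+1 * r)./2 *
    \sum_(J : r.+1.-tuple 'I_k | sorted ltn [seq val j | j <- J])
      ham_coef J x * foldr (fun j X => X_hat j \o X) id J f x.

End Operators.

(* Main.v *)
(* Evaluated on a character [x |-> t^x] of the lattice, [T_hat i] becomes the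
   operator [phi + (1 - phi) s_i] with [phi] a rational function of [t]; a
   finitely supported functional that kills the characters at all points [t]
   with distinct nonzero coordinates is zero, so the braid relations, and the
   values of [T_hat i f] on and next to the wall of [s_i], are identities
   between rational functions.

   The functional [E_x : f |-> G f x] is evaluation at [x] if [x] is dominant,
   and [E_x = E_{s_i x} o T_i] whenever [x_i <= x_{i+1}].  Both sides of
   [H G = G (sum X_i)] transform in this way under ascents of [x], so it is
   enough to compare them at a dominant [x].  There one inducts on the number
   [n] of leading coordinates that are sorted by a partial propagation [G^n].
   If [x_j >= x_n - 1] for [j < n] and the set [D] of those [j] with equality
   has [r] elements, then
     G^{n+1} f (x) = (1 + beta gamma [r]) G^n f (x)
       + beta delta [r] G^n f (x - v_n)
       + sum_{j in D} q^{#{p in D, p > j}} (alpha gamma G^n f (x + v_j)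
                                   + alpha delta G^n f (x + v_j - v_n)),
   and the coefficients of [H] are precisely those for which the weighted sum
   of these relations over the subsets [D] of a block of equal coordinates
   telescopes to [f (x - v_n)]. *)
Require Import Defs.
From HB Require Import structures.
From mathcomp Require Import all_boot all_order all_algebra finmap.
From mathcomp Require Import classical_sets boolp reals complex monalg.
From mathcomp Require Import perm ring zify.

Set Implicit Arguments.
Unset Strict Implicit.
Unset Printing Implicit Defensive.

Import boot.finset Order.TTheory GRing.Theory Num.Theory.

Local Open Scope ring_scope.

(** * Characters of the lattice *)

Section Lattice.
Variable k : nat.
Implicit Types (x y : lattice k) (i j : 'I_k.-1) (p : 'I_k).

Definition swap_pos i : 'I_k -> 'I_k := tperm (lft i) (rgt i).

Lemma lft_neq_rgt i : lft i != rgt i.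
Proof. by rewrite -val_eqE /= neq_ltn leqnn. Qed.

Lemma swap_posK i : involutive (swap_pos i).
Proof. exact: tpermK. Qed.

Lemma swap_posL i : swap_pos i (lft i) = rgt i. Proof. exact: tpermL. Qed.
Lemma swap_posR i : swap_pos i (rgt i) = lft i. Proof. exact: tpermR. Qed.

Lemma swap_posD i p : p != lft i -> p != rgt i -> swap_pos i p = p.
Proof. by move=> ? ?; rewrite /swap_pos tpermD 1?eq_sym. Qed.

Lemma swap_posE i p : swap_pos i p =
  (if p == i :> nat then i.+1 else if p == i.+1 :> nat then (i : nat) else p) :> nat.
Proof.
rewrite /swap_pos; case: tpermP => [->|->|/eqP + /eqP].
- by rewrite /= eqxx.
- by rewrite /= eqxx eqn_leq ltnn.
- by rewrite -!val_eqE /= => /negPf -> /negPf ->.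
Qed.

Lemma swap_pos_comm i j p : (i.+1 < j)%N ->
  swap_pos i (swap_pos j p) = swap_pos j (swap_pos i p).
Proof. by move=> ij; apply: ord_inj; rewrite !swap_posE; do !case: eqP; lia. Qed.

Lemma swap_pos_braid i j p : j = i.+1 :> nat ->
  swap_pos i (swap_pos j (swap_pos i p)) = swap_pos j (swap_pos i (swap_pos j p)).
Proof. by move=> ij; apply: ord_inj; rewrite !swap_posE; do !case: eqP; lia. Qed.

Lemma vbasisE p p' : vbasis_elt p p' 0 = (p' == p)%:R.
Proof. by rewrite !mxE eqxx andbT. Qed.

Lemma simple_refl_entry i x p : (simple_refl i *m x) p 0 = x (swap_pos i p) 0.
Proof.
rewrite simple_reflE alpha_rootE /simple_coroot !mxE !eqxx !andbT.
have lr := lft_neq_rgt i; have rl := lr; rewrite eq_sym in rl.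
rewrite /swap_pos; case: tpermP => [->|->|/eqP/negPf -> /eqP/negPf ->].
- by rewrite eqxx (negPf lr) /= subr0 mulr1; lia.
- by rewrite eqxx (negPf rl) /= sub0r; lia.
- by rewrite /= subrr mulr0 subr0.
Qed.

Lemma simple_reflK i x : simple_refl i *m (simple_refl i *m x) = x.
Proof. by apply/matrixP=> p o; rewrite ord1 !simple_refl_entry swap_posK. Qed.

Lemma simple_refl_vbasis i p :
  simple_refl i *m vbasis_elt p = vbasis_elt (swap_pos i p) :> lattice k.
Proof.
apply/matrixP=> p' o; rewrite ord1 simple_refl_entry !vbasisE.
by rewrite (inv_eq (swap_posK i)).
Qed.

(** Removes the inverse matrix from [lact], since reflections are involutions. *)
Lemma invmx_simple_refl i : invmx (simple_refl i) = simple_refl i.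
Proof.
have E : simple_refl i *m simple_refl i = 1%:M.
  apply/matrixP => p p'; have := simple_reflK i (vbasis_elt p').
  rewrite mulmxA -[RHS]mul1mx /vbasis_elt -!colE => /matrixP/(_ p 0).
  by rewrite 2![(col _ _) _ _]mxE.
have U : simple_refl i \in unitmx by case/mulmx1_unit: E.
by apply: (can_inj (mulKmx U)); rewrite mulmxV.
Qed.

Lemma simple_refl_id i x : x (lft i) 0 = x (rgt i) 0 -> simple_refl i *m x = x.
Proof.
move=> e; apply/matrixP=> p o; rewrite ord1 simple_refl_entry /swap_pos.
by case: tpermP => // ->.
Qed.

End Lattice.

(** * Distinct primes and unique factorization *)

Section Primes.

Fixpoint increasing_primes (n : nat) : nat :=
  if n is n'.+1 then s2val (prime_above (increasing_primes n')) else 2.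

Lemma increasing_primes_prime n : prime (increasing_primes n).
Proof. by case: n => [|n] //=; case: prime_above. Qed.

Lemma increasing_primes_inj : injective increasing_primes.
Proof.
have lt_S n : (increasing_primes n < increasing_primes n.+1)%N.
  by rewrite /=; case: prime_above.
have mono : {homo increasing_primes : m n / (m < n)%N}.
  by apply: homo_ltn lt_S => ? ? ?; apply: ltn_trans.
by move=> m n e; case: (ltngtP m n) => // /mono; rewrite e ltnn.
Qed.

Lemma logn_prod_primes (I : finType) (p e : I -> nat) (j : I) :
  (forall i, prime (p i)) -> injective p ->
  logn (p j) (\prod_i p i ^ e i) = e j.
Proof.
move=> pP pI.
have pos (P : pred I) : (0 < \prod_(i | P i) p i ^ e i)%N.
  by rewrite prodn_cond_gt0 // => i _; rewrite expn_gt0 prime_gt0.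
rewrite (bigD1 j) //= lognM ?pos ?expn_gt0 ?prime_gt0 //.
rewrite lognX logn_prime // eqxx muln1 logn_coprime ?addn0 //.
elim/big_ind: _ => [|a b ca cb|i ne]; [by rewrite coprimen1|by rewrite coprimeMr ca|].
rewrite coprimeXr // prime_coprime // dvdn_prime2 //.
by rewrite (inj_eq pI) eq_sym.
Qed.

End Primes.

(** * Separation of lattice points by characters in characteristic zero *)

Section Characters.
Variables (C : fieldType) (k : nat).
Hypothesis C0 : [pchar C] =i pred0.
Implicit Types (x y : lattice k) (t : 'I_k -> C) (f g : fun_space C k).

Lemma natr_inj0 (m n : nat) : m%:R = n%:R :> C -> m = n.
Proof.
have inj a b : a%:R = (a + b)%:R :> C -> b = 0%N.
  rewrite natrD -[LHS]addr0 => /addrI/esym/eqP.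
  by rewrite ((pcharf0P C).1 C0) => /eqP.
case: (leqP m n) => [/subnKC|/ltnW/subnKC] <- => [/inj ->|/esym/inj ->];
  by rewrite addn0.
Qed.

Definition char_fun t : fun_space C k := fun x => \prod_i t i ^ x i 0.

(** Nonzero coordinates make [char_fun t] multiplicative on the lattice; distinct coordinates make
    the denominators of the operators invertible. *)
Definition regular_point t := (forall i, t i != 0) /\ injective t.

Lemma char_funD t x y : (forall i, t i != 0) ->
  char_fun t (x + y) = char_fun t x * char_fun t y.
Proof.
move=> t0; rewrite /char_fun -big_split; apply: eq_bigr => i _ /=.
by rewrite mxE expfzDr.
Qed.

Lemma char_fun0 t : char_fun t 0 = 1.
Proof. by rewrite /char_fun big1 // => i _; rewrite mxE. Qed.

Lemma char_fun_neq0 t x : (forall i, t i != 0) -> char_fun t x != 0.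
Proof. by move=> t0; apply/prodf_neq0 => i _; apply: expfz_neq0. Qed.

Lemma char_funN t x : (forall i, t i != 0) ->
  char_fun t (- x) = (char_fun t x)^-1.
Proof.
move=> t0; apply: (mulfI (char_fun_neq0 x t0)).
by rewrite -char_funD // subrr char_fun0 mulfV ?char_fun_neq0.
Qed.

Lemma char_fun_vbasis t p : char_fun t (vbasis_elt p) = t p.
Proof.
rewrite /char_fun (bigD1 p) //= big1 ?mulr1 => [|i /negPf ne].
  by rewrite vbasisE eqxx.
by rewrite vbasisE ne.
Qed.

Lemma char_fun_simple_refl t i x :
  char_fun t (simple_refl i *m x) = char_fun (t \o swap_pos i) x.
Proof.
rewrite /char_fun (reindex_inj (inv_inj (@swap_posK k i))).
by apply: eq_bigr => p _; rewrite simple_refl_entry swap_posK.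
Qed.

Lemma char_fun_pow t n x :
  char_fun (fun i => t i ^+ n) x = char_fun t x ^+ n.
Proof.
rewrite /char_fun -prodrXl; apply: eq_bigr => i _.
by rewrite !exprnP !exprz_exp mulrC.
Qed.

Definition prime_point : 'I_k -> C := fun i => (increasing_primes i)%:R.

Lemma prime_point_neq0 i : prime_point i != 0.
Proof. by rewrite ((pcharf0P C).1 C0) -lt0n prime_gt0 // increasing_primes_prime. Qed.

Lemma regular_prime_point n : regular_point (fun i => prime_point i ^+ n.+1).
Proof.
split=> [i|i j]; first by rewrite expf_neq0 // prime_point_neq0.
rewrite /prime_point -!natrX => /natr_inj0/eqP; rewrite eqn_exp2r // => /eqP.
by move/increasing_primes_inj/val_inj.
Qed.

(** Unique factorization: once negative exponents are cleared, a character value equal to 1 is an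
    equality between two products of powers of the same distinct primes, so the exponents agree. *)
Lemma char_prime_point_inj : injective (char_fun prime_point).
Proof.
suff ker z : char_fun prime_point z = 1 -> z = 0.
  move=> x y e; apply/eqP; rewrite -subr_eq0; apply/eqP/ker.
  have ne := prime_point_neq0.
  by rewrite char_funD // char_funN // e mulfV ?char_fun_neq0.
(* The positive part: an exponent [n] splits as [pos n - pos (- n)], and the negative part moves to
   the other side. *)
pose pos (n : int) : nat := if n is Posz m then m else 0%N.
have posE n : n = (pos n)%:Z - (pos (- n))%:Z by case: n => [[|m]|m] //=; rewrite ?subr0 ?sub0r //.
pose pr (i : 'I_k) := increasing_primes i.
have prP i : prime (pr i) by exact: increasing_primes_prime.
have prI : injective pr by move=> i j /increasing_primes_inj/val_inj.
move=> e.
have E : (\prod_i pr i ^ pos (z i ord0) = \prod_i pr i ^ pos (- z i ord0))%N.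
  apply: natr_inj0; rewrite !natr_prod.
  transitivity (char_fun prime_point z * \prod_i (pr i ^ pos (- z i ord0))%:R).
    rewrite /char_fun -big_split; apply: eq_bigr => i _ /=.
    rewrite !natrX -/(prime_point i) !exprnP -expfzDr ?prime_point_neq0 //.
    by congr (_ ^ _); apply/eqP; rewrite -subr_eq; apply/eqP; rewrite [RHS]posE.
  by rewrite e mul1r.
apply/matrixP=> j o; rewrite ord1 !mxE [LHS]posE.
have := congr1 (logn (pr j)) E; rewrite !logn_prod_primes // => ->.
by rewrite subrr.
Qed.

Lemma lpairingE (P : group_alg C k) f : lpairing P f = mmap idfun f P.
Proof. by []. Qed.

Lemma lpairing_lexp x f : lpairing (lexp C x) f = f x.
Proof. by rewrite lpairingE mmapU mul1r. Qed.

(* Powers of [prime_point] show that the power sums of the distinct numbers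
   [char_fun prime_point x], weighted by the coefficients of [P], vanish; the
   same then holds for every polynomial in these numbers. *)
Lemma char_fun_dense (P : group_alg C k) :
  (forall t, regular_point t -> lpairing P (char_fun t) = 0) -> P = 0.
Proof.
move=> P0; pose lam := char_fun prime_point.
(* The extra factor [lam x] keeps the exponents positive: the zeroth power of [prime_point] has all
   coordinates equal to 1 and is not regular in general. *)
have pol (h : {poly C}) :
    \sum_(x <- msupp P) P@_x * (lam x * h.[lam x]) = 0.
  rewrite (eq_bigr (fun x => \sum_(i < size h) h`_i * (P@_x * lam x ^+ i.+1)));
    last first.
    move=> x _; rewrite horner_coef !mulr_sumr; apply: eq_bigr => i _.
    by rewrite exprS; ring.
  rewrite exchange_big big1 //= => i _; rewrite -mulr_sumr.
  rewrite (eq_bigr (fun x => P@_x * char_fun (fun j => prime_point j ^+ i.+1) x)).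
    by rewrite -/(lpairing _ _) P0 ?mulr0 //; apply: regular_prime_point.
  by move=> x _; rewrite char_fun_pow.
apply/malgP => x; rewrite mcoeff0; apply/eqP/negPn/negP; rewrite mcoeff_neq0 => xP.
(* This polynomial vanishes at [lam y] for every other [y] of the support, so only the coefficient
   of [x] survives. *)
have /eqP := pol (\prod_(y <- msupp P | y != x) ('X - (lam y)%:P)).
rewrite [X in X == _](bigD1_seq x) //= [X in _ + X]big1_seq ?addr0 => [|y /andP[yx yP]].
  rewrite !mulf_eq0 mcoeff_eq0 xP (negPf (char_fun_neq0 _ prime_point_neq0)) /=.
  rewrite horner_prod prodf_seq_eq0 => /hasP[y yP /andP[yx]].
  rewrite hornerXsubC subr_eq0 => /eqP/char_prime_point_inj e.
  by rewrite e eqxx in yx.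
rewrite (_ : horner _ _ = 0) ?mulr0 //.
apply/eqP; rewrite horner_prod prodf_seq_eq0; apply/hasP; exists y => //.
by rewrite yx hornerXsubC subrr eqxx.
Qed.

End Characters.

(** * The operators on characters *)

Section CheckOperators.
Variables (C : fieldType) (k : nat) (alpha beta gamma delta : C).
Hypothesis C0 : [pchar C] =i pred0.
Implicit Types (x y : lattice k) (t : 'I_k -> C) (f g : fun_space C k).
Implicit Types (P Q : group_alg C k) (i j : 'I_k.-1).

Lemma lpairingD P Q f : lpairing (P + Q) f = lpairing P f + lpairing Q f.
Proof. by rewrite !lpairingE raddfD. Qed.

Lemma lpairingB P Q f : lpairing (P - Q) f = lpairing P f - lpairing Q f.
Proof. by rewrite !lpairingE raddfB. Qed.

Lemma lpairingN P f : lpairing (- P) f = - lpairing P f.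
Proof. by rewrite !lpairingE raddfN. Qed.

Lemma lpairing0 f : lpairing (0 : group_alg C k) f = 0.
Proof. by rewrite lpairingE raddf0. Qed.

Lemma lpairingU (c : C) x f : lpairing (<< c *g x >> : group_alg C k) f = c * f x.
Proof. by rewrite lpairingE mmapU. Qed.

Lemma lpairing_sum I (r : seq I) (F : I -> group_alg C k) f :
  lpairing (\sum_(i <- r) F i) f = \sum_(i <- r) lpairing (F i) f.
Proof. by rewrite !lpairingE raddf_sum. Qed.

Lemma lpairing_lmul P Q t : (forall p, t p != 0) ->
  lpairing (lmul P Q) (char_fun t) =
  lpairing P (char_fun t) * lpairing Q (char_fun t).
Proof.
move=> t0; rewrite /lmul lpairing_sum {2}/lpairing mulr_suml; apply: eq_bigr => x _.
rewrite lpairing_sum {2}/lpairing mulr_sumr; apply: eq_bigr => y _.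
by rewrite lpairingU char_funD //; ring.
Qed.

Lemma lpairing_char_inj P Q :
  (forall t, regular_point t ->
     lpairing P (char_fun t) = lpairing Q (char_fun t)) -> P = Q.
Proof.
move=> PQ; apply/eqP; rewrite -subr_eq0; apply/eqP/(char_fun_dense C0) => t tR.
by rewrite lpairingB PQ // subrr.
Qed.

Lemma lact_lexp x i :
  lact (lexp C x) (simple_refl i) = lexp C (simple_refl i *m x).
Proof.
by rewrite /lact /lexp msuppU oner_eq0 big_seq_fset1 mcoeffUU invmx_simple_refl.
Qed.

Lemma regular_swap t i : regular_point t -> regular_point (t \o swap_pos i).
Proof.
by case=> t0 tI; split=> [p|p p' /tI /(inv_inj (@swap_posK _ i))//]; apply: t0.
Qed.

Definition divided_difference i x Q := forall t, regular_point t ->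
  (t (lft i) - t (rgt i)) * lpairing Q (char_fun t) =
  char_fun t x - char_fun t (simple_refl i *m x).

(** Induction on the gap [x_i - x_{i+1}], when it is nonnegative. With [y = x - v_i], a quotient for
    [x] is [e^{v_i}] times a quotient for [y], plus [e^{s_i y}], because
    [s_i x = s_i y + v_{i+1}]. *)
Lemma divided_difference_exists i x : exists Q, divided_difference i x Q.
Proof.
have pos n y : y (lft i) 0 - y (rgt i) 0 = n%:Z -> exists Q, divided_difference i y Q.
  elim: n y => [|n IH] y e.
    exists 0 => t _; rewrite lpairing0 mulr0 simple_refl_id ?subrr //.
    by apply/eqP; rewrite -subr_eq0 e.
  have [|Q QP] := IH (y - vbasis_elt (lft i)).
    rewrite !mxE eqxx [rgt i == _]eq_sym (negPf (lft_neq_rgt i)) eqxx /=; lia.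
  exists (lmul (lexp C (vbasis_elt (lft i))) Q
     + lexp C (simple_refl i *m (y - vbasis_elt (lft i)))) => t tR.
  have [t0 _] := tR; have := QP t tR.
  rewrite lpairingD (lpairing_lmul _ _ t0) !lpairing_lexp mulmxBr simple_refl_vbasis.
  rewrite swap_posL !char_funD // !char_funN // !char_fun_vbasis.
  set a := lpairing _ _ => E.
  rewrite mulrDr mulrCA E; field; rewrite !t0 //.
have [|] := lerP 0 (x (lft i) 0 - x (rgt i) 0).
  by case E : (_ - _) => [n|n] // _; apply: (pos n).
(* A negative gap becomes positive at [s_i x], and exchanging [x] with [s_i x] changes the sign of
   the quotient. *)
move=> lt; have [n e] : exists n : nat, x (rgt i) 0 - x (lft i) 0 = n%:Z.
  by exists (absz (x (rgt i) 0 - x (lft i) 0)%R); lia.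
have [|Q QP] := pos n (simple_refl i *m x).
  by rewrite !simple_refl_entry swap_posL swap_posR.
exists (- Q) => t tR; rewrite lpairingN mulrN QP // simple_reflK; ring.
Qed.

Lemma lpairing_lmulB P P' Q t : (forall p, t p != 0) ->
  lpairing (lmul (P - P') Q) (char_fun t) =
  (lpairing P (char_fun t) - lpairing P' (char_fun t)) * lpairing Q (char_fun t).
Proof. by move=> t0; rewrite (lpairing_lmul _ _ t0) lpairingB. Qed.

Lemma lpairing_add_lmul S P P' P1 P1' Q t : (forall p, t p != 0) ->
  lpairing (S + lmul (lmul (P + P') (P1 + P1')) Q) (char_fun t) =
  lpairing S (char_fun t)
  + (lpairing P (char_fun t) + lpairing P' (char_fun t))
    * (lpairing P1 (char_fun t) + lpairing P1' (char_fun t))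
    * lpairing Q (char_fun t).
Proof. by move=> t0; rewrite lpairingD !(lpairing_lmul _ _ t0) !lpairingD. Qed.

Lemma lpairing_lconst_mul (c : C) x t : (forall p, t p != 0) ->
  lpairing (lmul (lconst k c) (lexp C x)) (char_fun t) = c * char_fun t x.
Proof.
by move=> t0; rewrite (lpairing_lmul _ _ t0) lpairing_lexp lpairingU char_fun0 mulr1.
Qed.

Lemma lpairing_lconst (c : C) t : lpairing (lconst k c) (char_fun t) = c.
Proof. by rewrite lpairingU char_fun0 mulr1. Qed.

(** Shows that the [xget] inside [ldiv] does not fall back on its default: a quotient exists when
    tested on regular characters, and these separate elements of the group algebra. *)
Lemma lmul_ldiv i x :
  lmul (lexp C (vbasis_elt (lft i)) - lexp C (vbasis_elt (rgt i)))
    (ldiv (lexp C x - lexp C (simple_refl i *m x))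
       (lexp C (vbasis_elt (lft i)) - lexp C (vbasis_elt (rgt i))))
  = lexp C x - lexp C (simple_refl i *m x).
Proof.
have [Q QP] := divided_difference_exists i x.
rewrite /ldiv; case: xgetP => [Q' _ //|noQ]; case: (noQ Q) => {noQ}.
apply: lpairing_char_inj => t tR; have [t0 _] := tR.
apply: etrans (lpairing_lmulB _ _ _ t0) _; apply: etrans (esym (lpairingB _ _ _)).
by rewrite !lpairing_lexp !char_fun_vbasis; apply: QP.
Qed.

Definition hecke_phi t i : C :=
  (alpha * t (lft i) + beta) * (gamma * t (rgt i) + delta) /
  (t (lft i) - t (rgt i)).

Lemma T_hat_char i t x : regular_point t ->
  T_hat alpha beta gamma delta i (char_fun t) x =
  hecke_phi t i * char_fun t x
  + (1 - hecke_phi t i) * char_fun (t \o swap_pos i) x.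
Proof.
move=> tR; have [t0 tI] := tR.
have d0 : t (lft i) - t (rgt i) != 0.
  by rewrite subr_eq0 (inj_eq tI) lft_neq_rgt.
rewrite /T_hat /T_check lact_lexp; move: (lmul_ldiv i x); move: (ldiv _ _) => Q E.
have := congr1 (fun Q => lpairing Q (char_fun t)) E => {E} /= E.
have {}E := etrans (esym (lpairing_lmulB _ _ _ t0)) (etrans E (lpairingB _ _ _)).
have {}E : (t (lft i) - t (rgt i)) * lpairing Q (char_fun t)
    = char_fun t x - char_fun t (simple_refl i *m x).
  apply: etrans (etrans _ E) _; first by congr ((_ - _) * _);
    rewrite lpairing_lexp char_fun_vbasis.
  by congr (_ - _); apply: lpairing_lexp.
transitivity (char_fun t (simple_refl i *m x)
  + (alpha * t (lft i) + beta) * (gamma * t (rgt i) + delta)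
    * lpairing Q (char_fun t)).
  apply: etrans (lpairing_add_lmul _ _ _ _ _ _ t0) _.
  congr (_ + (_ + _) * (_ + _) * _);
    [exact: lpairing_lexp| | exact: lpairing_lconst| |exact: lpairing_lconst];
    by apply: etrans (lpairing_lconst_mul _ _ t0) _; rewrite char_fun_vbasis.
move: (lpairing Q _) E => a E.
apply: (mulfI d0); rewrite mulrDr mulrCA E.
rewrite -char_fun_simple_refl /hecke_phi; field.
exact: d0.
Qed.

(** Functionals represented by a Laurent polynomial. The class is stable under composition with the
    operators, and by [finitary_eq] two members agree once they agree on regular characters, where
    the identities become rational. *)
Definition finitary (F : fun_space C k -> C) :=
  exists P : group_alg C k, forall f, F f = lpairing P f.

Lemma finitary_eq F G : finitary F -> finitary G ->
  (forall t, regular_point t -> F (char_fun t) = G (char_fun t)) ->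
  forall f, F f = G f.
Proof.
move=> [P PP] [Q QP] FG f; rewrite PP QP; congr lpairing.
by apply: lpairing_char_inj => t tR; rewrite -PP -QP FG.
Qed.

Lemma finitary_eval x : finitary (fun f => f x).
Proof. by exists (lexp C x) => f; rewrite lpairing_lexp. Qed.

Lemma finitary_scale c F : finitary F -> finitary (fun f => c * F f).
Proof.
case=> P PP; exists (\sum_(x <- msupp P) << c * P@_x *g x >>) => f.
rewrite PP lpairing_sum mulr_sumr; apply: eq_bigr => x _.
by rewrite lpairingU mulrA.
Qed.

Lemma finitary_add F G :
  finitary F -> finitary G -> finitary (fun f => F f + G f).
Proof.
by move=> [P PP] [Q QP]; exists (P + Q) => f; rewrite lpairingD PP QP.
Qed.

Lemma finitary_sum I (r : seq I) (F : I -> fun_space C k -> C) :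
  (forall a, finitary (F a)) -> finitary (fun f => \sum_(a <- r) F a f).
Proof.
move=> fin; elim: r => [|a r [P PP]].
  by exists 0 => f; rewrite big_nil lpairing0.
have [Q QP] := fin a; exists (Q + P) => f.
by rewrite big_cons lpairingD PP QP.
Qed.

Lemma finitary_T i F : finitary F ->
  finitary (fun f => F (T_hat alpha beta gamma delta i f)).
Proof.
move=> [P PP].
have [Q QP] : finitary (fun f => \sum_(x <- msupp P)
    (P@_x * T_hat alpha beta gamma delta i f x)).
  (* The representing element of [f |-> T_hat i f x] is [T_check i (lexp C x)], found by
     unification. *)
  by apply: finitary_sum => x; apply: finitary_scale; eexists.
by exists Q => f; rewrite PP -QP.
Qed.

Lemma finitary_X_sum F : finitary F -> finitary (fun f => F (X_hat_sum f)).
Proof.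
move=> [P PP].
have [Q QP] : finitary (fun f => \sum_(x <- msupp P) (P@_x * X_hat_sum f x)).
  apply: finitary_sum => x; apply: finitary_scale; apply: finitary_sum => i.
  exact: finitary_eval.
by exists Q => f; rewrite PP -QP.
Qed.

Local Notation T := (T_hat alpha beta gamma delta).

Lemma T_hat_lin i (a b : C) f g :
  T i (fun x => a * f x + b * g x) = (fun x => a * T i f x + b * T i g x).
Proof.
apply: funext => x; rewrite /T_hat /lpairing !mulr_sumr -big_split /=.
by apply: eq_bigr => y _; ring.
Qed.

Lemma T_hat_scale i (a : C) f : T i (fun x => a * f x) = (fun x => a * T i f x).
Proof.
apply: funext => x; rewrite /T_hat /lpairing mulr_sumr /=.
by apply: eq_bigr => y _; ring.
Qed.

Lemma T_hat_charE i t : regular_point t ->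
  T i (char_fun t) = (fun x => hecke_phi t i * char_fun t x
    + (1 - hecke_phi t i) * char_fun (t \o swap_pos i) x).
Proof. by move=> tR; apply: funext => x; apply: T_hat_char. Qed.

(** Here [s_i x = x], so the two coefficients [phi] and [1 - phi] add up to 1. *)
Lemma T_hat_wall i f x : x (lft i) 0 = x (rgt i) 0 -> T i f x = f x.
Proof.
move=> e; move: f; apply: finitary_eq; rewrite ?T_hat_charE.
- exact: (finitary_T i (finitary_eval x)).
- exact: finitary_eval.
move=> t tR; rewrite T_hat_charE // -char_fun_simple_refl simple_refl_id //; ring.
Qed.

(** On a character the difference of the values at [x] and [s_i x] has the factor [t_i - t_{i+1}],
    which cancels the denominator of [hecke_phi]. Expanding the product of the two linear factors
    leaves one term for each of its four monomials. *)
Lemma T_hat_adjacent i f x : x (lft i) 0 = x (rgt i) 0 + 1 ->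
  T i f x = (1 + beta * gamma) * f (simple_refl i *m x) + alpha * delta * f x
    + alpha * gamma * f (x + vbasis_elt (rgt i))
    + beta * delta * f (x - vbasis_elt (lft i)).
Proof.
move=> e; have sx : simple_refl i *m x = x - vbasis_elt (lft i) + vbasis_elt (rgt i).
  rewrite simple_reflE alpha_rootE e addrAC subrr add0r scale1r /simple_coroot.
  by rewrite opprB addrA addrAC.
move: f; apply: finitary_eq.
- exact: (finitary_T i (finitary_eval x)).
- by do ?[apply: finitary_eval | apply: finitary_scale | apply: finitary_add].
move=> t tR; have [t0 tI] := tR.
have d0 : t (lft i) - t (rgt i) != 0.
  by rewrite subr_eq0 (inj_eq tI) lft_neq_rgt.
rewrite T_hat_charE // -char_fun_simple_refl sx !char_funD // char_funN //.
rewrite !char_fun_vbasis /hecke_phi; field.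
by rewrite d0 !t0.
Qed.

(** A character is an eigenfunction of [X_hat_sum], with an eigenvalue symmetric in the coordinates
    of [t]; the two characters that [T i] mixes therefore share it. *)
Lemma T_hat_X_sum i f : T i (X_hat_sum f) = X_hat_sum (T i f).
Proof.
apply: funext => x; move: f; apply: finitary_eq.
- exact: (finitary_X_sum (finitary_T i (finitary_eval x))).
- exact: (finitary_T i (finitary_X_sum (finitary_eval x))).
have X_char t : regular_point t ->
    X_hat_sum (char_fun t) = (fun y => (\sum_p (t p)^-1) * char_fun t y).
  case=> t0 _; apply: funext => y; rewrite /X_hat_sum mulr_suml.
  by apply: eq_bigr => p _; rewrite /X_hat char_funD // char_funN // char_fun_vbasis mulrC.
move=> t tR; have tR' := regular_swap i tR.
rewrite X_char // T_hat_scale T_hat_charE //.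
have -> : X_hat_sum (fun y => hecke_phi t i * char_fun t y
      + (1 - hecke_phi t i) * char_fun (t \o swap_pos i) y) x =
    hecke_phi t i * X_hat_sum (char_fun t) x
    + (1 - hecke_phi t i) * X_hat_sum (char_fun (t \o swap_pos i)) x.
  by rewrite /X_hat_sum !mulr_sumr -big_split.
have e : \sum_p ((t \o swap_pos i) p)^-1 = \sum_p (t p)^-1.
  by rewrite [RHS](reindex_inj (inv_inj (@swap_posK _ i))).
rewrite !X_char // e; ring.
Qed.

Lemma hecke_phi_swap t i j : hecke_phi (t \o swap_pos i) j =
  (alpha * t (swap_pos i (lft j)) + beta) * (gamma * t (swap_pos i (rgt j)) + delta) /
  (t (swap_pos i (lft j)) - t (swap_pos i (rgt j))).
Proof. by []. Qed.

Lemma T_hat_comm i j f : (i.+1 < j)%N -> T i (T j f) = T j (T i f).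
Proof.
move=> ij; apply: funext => x; move: f; apply: finitary_eq.
- exact: (finitary_T j (finitary_T i (finitary_eval x))).
- exact: (finitary_T i (finitary_T j (finitary_eval x))).
(* An opaque [S], known only through linearity and its values on characters, lets both sides expand
   by rewriting alone. *)
move=> t tR; move: (T_hat alpha beta gamma delta) T_hat_lin T_hat_charE => S lin chE.
have tRi := regular_swap i tR; have tRj := regular_swap j tR.
have fix_ (p : 'I_k) (a : 'I_k.-1) :
    (p != a :> nat) -> (p != a.+1 :> nat) -> swap_pos a p = p.
  by move=> *; apply: swap_posD; rewrite -val_eqE.
have iE : hecke_phi (t \o swap_pos j) i = hecke_phi t i.
  by rewrite hecke_phi_swap !fix_ //=; lia.
have jE : hecke_phi (t \o swap_pos i) j = hecke_phi t j.
  by rewrite hecke_phi_swap !fix_ //=; lia.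
have sw : (t \o swap_pos j) \o swap_pos i = (t \o swap_pos i) \o swap_pos j.
  by apply: funext => p /=; rewrite (swap_pos_comm _ ij).
rewrite !(chE _ _ tR, chE _ _ tRi, chE _ _ tRj, lin) iE jE sw; ring.
Qed.

(** Both sides expand in the characters at the images of [t] under the permutations of three
    neighbouring coordinates; the coefficients agree as rational functions of [t]. *)
Lemma T_hat_braid i j f : j = i.+1 :> nat ->
  T i (T j (T i f)) = T j (T i (T j f)).
Proof.
move=> ij; apply: funext => x; move: f; apply: finitary_eq.
- exact: (finitary_T i (finitary_T j (finitary_T i (finitary_eval x)))).
- exact: (finitary_T j (finitary_T i (finitary_T j (finitary_eval x)))).
move=> t tR; move: (T_hat alpha beta gamma delta) T_hat_lin T_hat_charE => S lin chE.
have [t0 tI] := tR.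
have tRi := regular_swap i tR; have tRj := regular_swap j tR.
have tRij := regular_swap j tRi; have tRji := regular_swap i tRj.
have swii : (t \o swap_pos i) \o swap_pos i = t.
  by apply: funext => p /=; rewrite swap_posK.
have swjj : (t \o swap_pos j) \o swap_pos j = t.
  by apply: funext => p /=; rewrite swap_posK.
have sw : ((t \o swap_pos j) \o swap_pos i) \o swap_pos j =
    ((t \o swap_pos i) \o swap_pos j) \o swap_pos i.
  by apply: funext => p /=; rewrite (swap_pos_braid _ ij).
have lj : lft j = rgt i by apply: ord_inj.
have iP : swap_pos i (rgt j) = rgt j by apply: swap_posD; rewrite -val_eqE /=; lia.
have jP : swap_pos j (lft i) = lft i by apply: swap_posD; rewrite -val_eqE /=; lia.
have jL : swap_pos j (rgt i) = rgt j by rewrite -lj swap_posL.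
have jR : swap_pos j (rgt j) = rgt i by rewrite swap_posR.
rewrite !(chE _ _ tR, chE _ _ tRi, chE _ _ tRj, chE _ _ tRij, chE _ _ tRji, lin).
rewrite swii swjj sw /hecke_phi /= lj.
rewrite !(swap_posL i, swap_posR i, iP, jP, jL, jR).
have d p p' : p != p' -> t p - t p' != 0 by rewrite subr_eq0 (inj_eq tI).
field.
rewrite !d // -?val_eqE /=; lia.
Qed.

End CheckOperators.

(** * Sorting words and inversions *)

Section Sorting.
Variable k : nat.
Implicit Types (x y : lattice k) (i j : 'I_k.-1) (p : 'I_k) (n : nat).

Local Notation s_ i x := (simple_refl i *m x).

Lemma simple_refl_comm i j x : (i.+1 < j)%N -> s_ i (s_ j x) = s_ j (s_ i x).
Proof.
move=> ij; apply/matrixP => p o; rewrite ord1 !simple_refl_entry.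
by rewrite (swap_pos_comm _ ij).
Qed.

Lemma simple_refl_braid i j x : j = i.+1 :> nat ->
  s_ i (s_ j (s_ i x)) = s_ j (s_ i (s_ j x)).
Proof.
move=> ij; apply/matrixP => p o; rewrite ord1 !simple_refl_entry.
by rewrite (swap_pos_braid _ ij).
Qed.

Lemma swap_pos_far i p : p != i :> nat -> p != i.+1 :> nat -> swap_pos i p = p.
Proof. by move=> pi pi1; apply: swap_posD; rewrite -val_eqE. Qed.

Definition chamber n x : bool :=
  [forall i : 'I_k.-1, (i.+1 < n)%N ==> (x (rgt i) 0 <= x (lft i) 0)].

Lemma chamber_le n x p p' : chamber n x -> (p <= p' < n)%N -> x p' 0 <= x p 0.
Proof.
move=> ch /andP[pp' p'n]; move En : (p' - p)%N => d.
elim: d p' En pp' p'n => [|d IH] p' En pp' p'n.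
  by rewrite (_ : p' = p) //; apply: ord_inj; lia.
have p'0 : (p'.-1 < k.-1)%N by have := ltn_ord p'; lia.
pose i := Ordinal p'0.
have er : rgt i = p' by apply: ord_inj => /=; lia.
have/forallP/(_ i)/implyP := ch; rewrite er /= => le1.
apply: le_trans (IH (lft i) _ _ _); first apply: le1; rewrite /=; lia.
Qed.

Lemma chamberPn n x : ~~ chamber n x ->
  exists2 i : 'I_k.-1, (i.+1 < n)%N & x (lft i) 0 < x (rgt i) 0.
Proof.
by case/forallPn => i; rewrite negb_imply -ltNge => /andP[? ?]; exists i.
Qed.

(** Words that sort the first [n] coordinates by swapping strict ascents only, so that each letter
    removes exactly one inversion. The first letter acts first, the reverse of the order in
    [word_prod]. *)
Fixpoint sorts n x (u : seq 'I_k.-1) : bool :=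
  if u is i :: u' then
    [&& (i.+1 < n)%N, x (lft i) 0 < x (rgt i) 0 & sorts n (s_ i x) u']
  else chamber n x.

Fixpoint run (u : seq 'I_k.-1) x := if u is i :: u' then run u' (s_ i x) else x.

Definition inversions x : nat :=
  \sum_(p : 'I_k * 'I_k) ((p.1 < p.2)%N && (x p.1 0 < x p.2 0)%R).

(** Only the pair of positions [i], [i+1] can change its status; the other pairs are permuted among
    themselves. The additive form covers ascent, descent and equality at once. *)
Lemma inversions_swap i x :
  (inversions x + (x (rgt i) 0 < x (lft i) 0)%R =
   inversions (s_ i x) + (x (lft i) 0 < x (rgt i) 0)%R)%N.
Proof.
pose lr := (lft i, rgt i); pose rl := (rgt i, lft i).
have ne : rl != lr by rewrite xpair_eqE eq_sym (negPf (lft_neq_rgt i)).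
have split y : inversions y = ((y (lft i) 0 < y (rgt i) 0)%R +
    \sum_(p | (p != lr) && (p != rl)) ((p.1 < p.2)%N && (y p.1 0 < y p.2 0)%R))%N.
  by rewrite /inversions (bigD1 lr) //= ltnSn (bigD1 rl) //= ltnNge leqnSn.
rewrite !split !simple_refl_entry swap_posL swap_posR.
suff -> : (\sum_(p | (p != lr) && (p != rl))
    ((p.1 < p.2)%N && ((s_ i x) p.1 0 < (s_ i x) p.2 0)%R) =
    \sum_(p | (p != lr) && (p != rl)) ((p.1 < p.2)%N && (x p.1 0 < x p.2 0)%R))%N.
  lia.
pose h (p : 'I_k * 'I_k) := (swap_pos i p.1, swap_pos i p.2).
have hK : involutive h by case=> a b; rewrite /h /= !swap_posK.
rewrite (reindex_inj (inv_inj hK)); apply: eq_big => [[a b]|[a b]] /=.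
  rewrite !(inv_eq hK) /h /= swap_posL swap_posR -/lr -/rl; exact: andbC.
rewrite !simple_refl_entry !swap_posK => H; congr (nat_of_bool (_ && _)).
move: H; rewrite !(inv_eq hK) /h /= swap_posL swap_posR !xpair_eqE -!val_eqE /=.
by rewrite !swap_posE; do !case: eqP => /=; lia.
Qed.

Lemma inversions_ascent i x : x (lft i) 0 < x (rgt i) 0 ->
  inversions x = (inversions (s_ i x)).+1.
Proof. by move=> lt; have := inversions_swap i x; rewrite lt lt_gtF //; lia. Qed.

Lemma inversions_le i x : (inversions x <= (inversions (s_ i x)).+1)%N.
Proof. by have := inversions_swap i x; do 2!case: (_ < _); lia. Qed.

Lemma inversions_eq i x : inversions x = (inversions (s_ i x)).+1 ->
  x (lft i) 0 < x (rgt i) 0.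
Proof. by have := inversions_swap i x; do 2!case: (_ < _); lia. Qed.

Lemma inversions_chamber x : chamber k x -> inversions x = 0%N.
Proof.
move=> ch; apply: big1 => -[a b] _ /=; case: ltnP => //= ab.
by rewrite ltNge (chamber_le ch) //; rewrite ltnW //=.
Qed.

Lemma sorts_exists n x : exists u, sorts n x u.
Proof.
have [m] := ubnP (inversions x); elim: m x => // m IH x lem.
case: (boolP (chamber n x)) => [ch|/chamberPn[i i_n lt]]; first by exists [::].
have [|u su] := IH (s_ i x); first by move: lem; rewrite (inversions_ascent lt).
by exists (i :: u); rewrite /= i_n lt.
Qed.

Lemma size_sorts x u : sorts k x u -> size u = inversions x.
Proof.
elim: u x => [|i u IH] x /=; first by move/inversions_chamber ->.
by case/and3P => _ lt /IH ->; rewrite (inversions_ascent lt).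
Qed.

Lemma run_chamber n x u : sorts n x u -> chamber n (run u x).
Proof. by elim: u x => [|i u IH] x //= /and3P[_ _ /IH]. Qed.

Lemma leq_inversions_run u x : chamber k (run u x) -> (inversions x <= size u)%N.
Proof.
elim: u x => [|i u IH] x /=; first by move/inversions_chamber ->.
by move/IH => le; apply: leq_trans (inversions_le i x) _.
Qed.

(* A reflection removes at most one inversion, so a sorting word that is no
   longer than the number of inversions only swaps strict ascents. *)
Lemma sorts_run u x : chamber k (run u x) -> (size u <= inversions x)%N ->
  sorts k x u.
Proof.
elim: u x => [|i u IH] x //= ch le.
have le1 := leq_inversions_run ch; have le2 := inversions_le i x.
rewrite (inversions_eq (i := i)) ?IH //; try by lia.
by rewrite !andbT; have := ltn_ord i; lia.
Qed.

(** The coordinate at position [n] is minimal and is never moved by letters acting on the first [n]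
    positions, so the sorted prefix extends by one. *)
Lemma sorts_widen n (o : 'I_k) x u : o = n :> nat ->
  (forall p, (p < n)%N -> x o 0 <= x p 0) -> sorts n x u -> sorts n.+1 x u.
Proof.
move=> on; elim: u x => [|i u IH] x le /=.
  move=> ch; apply/forallP => i; apply/implyP; rewrite ltnS => i_n.
  have [lt|ge] := ltnP i.+1 n; first by move/forallP/(_ i)/implyP: ch; apply.
  have -> : rgt i = o by apply: ord_inj => /=; lia.
  by apply: le => /=; lia.
case/and3P => i_n lt su; rewrite ltnW //= lt /= IH // => p pn.
rewrite !simple_refl_entry swap_pos_far; try by rewrite on; lia.
by apply: le; rewrite swap_posE; do !case: eqP; lia.
Qed.

End Sorting.

(** * Partial propagation *)

Section PartialPropagation.
Variables (C : fieldType) (k : nat) (alpha beta gamma delta : C).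
Implicit Types (x y : lattice k) (i j : 'I_k.-1) (p : 'I_k) (n : nat).
Implicit Types (f g : fun_space C k).

Local Notation s_ i x := (simple_refl i *m x).

Variable T : 'I_k.-1 -> fun_space C k -> fun_space C k.
Hypothesis T_wall : forall i f x, x (lft i) 0 = x (rgt i) 0 -> T i f x = f x.
Hypothesis T_adjacent : forall i f x, x (lft i) 0 = x (rgt i) 0 + 1 ->
  T i f x = (1 + beta * gamma) * f (s_ i x) + alpha * delta * f x
    + alpha * gamma * f (x + vbasis_elt (rgt i))
    + beta * delta * f (x - vbasis_elt (lft i)).
Hypothesis T_comm : forall i j f, (i.+1 < j)%N -> T i (T j f) = T j (T i f).
Hypothesis T_braid : forall i j f, j = i.+1 :> nat ->
  T i (T j (T i f)) = T j (T i (T j f)).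

Fixpoint T_word (u : seq 'I_k.-1) f := if u is i :: u' then T_word u' (T i f) else f.

Lemma swap_far i j x : (i.+1 < j)%N ->
  (s_ i x) (lft j) 0 = x (lft j) 0 /\ (s_ i x) (rgt j) 0 = x (rgt j) 0.
Proof. by move=> ij; rewrite !simple_refl_entry !swap_pos_far //=; lia. Qed.

Lemma swap_far' i j x : (i.+1 < j)%N ->
  (s_ j x) (lft i) 0 = x (lft i) 0 /\ (s_ j x) (rgt i) 0 = x (rgt i) 0.
Proof. by move=> ij; rewrite !simple_refl_entry !swap_pos_far //=; lia. Qed.

Lemma swap_next i j x : j = i.+1 :> nat ->
  [/\ lft j = rgt i,
      ((s_ i x) (lft i) 0 = x (rgt i) 0) * ((s_ i x) (rgt i) 0 = x (lft i) 0)
      * ((s_ i x) (rgt j) 0 = x (rgt j) 0),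
      ((s_ j x) (lft i) 0 = x (lft i) 0) * ((s_ j x) (rgt i) 0 = x (rgt j) 0)
      * ((s_ j x) (rgt j) 0 = x (rgt i) 0) & swap_pos j (lft i) = lft i ].
Proof.
move=> ij; have lj : lft j = rgt i by apply: ord_inj.
have jL : swap_pos j (rgt i) = rgt j by rewrite -lj swap_posL.
have jR : swap_pos j (rgt j) = rgt i by rewrite swap_posR lj.
have jl : swap_pos j (lft i) = lft i by apply: swap_pos_far => /=; lia.
have ir : swap_pos i (rgt j) = rgt j by apply: swap_pos_far => /=; lia.
by rewrite !simple_refl_entry jL jR jl ir swap_posL swap_posR.
Qed.

(** Independence of the sorting word, by local confluence and induction on the number of
    inversions. *)
Lemma T_word_sorts n x u u' f : sorts n x u -> sorts n x u' ->
  T_word u f (run u x) = T_word u' f (run u' x).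
Proof.
have [m] := ubnP (inversions x); elim: m x u u' f => // m IH x u u' f lem.
have asc i : x (lft i) 0 < x (rgt i) 0 -> (inversions (s_ i x) < m)%N.
  by move=> lt; move: lem; rewrite (inversions_ascent lt).
have nch i v : sorts n x (i :: v) -> ~~ chamber n x.
  case/and3P => i_n lt _; apply/negP => /forallP/(_ i)/implyP/(_ i_n).
  by rewrite leNgt lt.
(* Two different first letters are completed to words with a common tail [w]: one more letter on
   each side if they commute, two more if they are neighbours and satisfy the braid relation. The
   induction hypothesis replaces the given tails by these. *)
have diamond i j v v' : (i < j)%N -> sorts n x (i :: v) -> sorts n x (j :: v') ->
    T_word v (T i f) (run v (s_ i x)) = T_word v' (T j f) (run v' (s_ j x)).
  move=> ij /and3P[i_n lti sv] /and3P[j_n ltj sv'].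
  have [far|near] := ltnP i.+1 j.
    have [w sw] := sorts_exists n (s_ j (s_ i x)).
    have [e1 e2] := swap_far x far; have [e1' e2'] := swap_far' x far.
    rewrite (IH _ _ (j :: w) _ (asc _ lti) sv) /=; last by rewrite j_n e1 e2 ltj.
    rewrite (IH _ _ (i :: w) _ (asc _ ltj) sv') /=; last first.
      by rewrite i_n e1' e2' lti (simple_refl_comm _ far).
    by rewrite (simple_refl_comm _ far) (T_comm _ far).
  have {near}ji : j = i.+1 :> nat by lia.
  have [w sw] := sorts_exists n (s_ i (s_ j (s_ i x))).
  have [lj ei ej _] := swap_next x ji; have [_ eij _ _] := swap_next (s_ j x) ji.
  have [_ _ eji _] := swap_next (s_ i x) ji.
  rewrite lj in ltj; have lt2 := lt_trans lti ltj.
  rewrite (IH _ _ (j :: i :: w) _ (asc _ lti) sv) /=; last first.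
    by rewrite i_n j_n lj !(ei, eji) lt2 ltj.
  rewrite (IH _ _ (i :: j :: w) _ (asc _ _) sv') /=; last 2 first.
  - by rewrite lj.
  - by rewrite i_n j_n lj !(ej, eij) lt2 lti -(simple_refl_braid _ ji).
  by rewrite (simple_refl_braid _ ji) (T_braid _ ji).
case: u u' => [|i v] [|j v'] // su su'.
- by case/negP: (nch _ _ su').
- by case/negP: (nch _ _ su).
move=> /=; have [ij|ji|/ord_inj ij] := ltngtP i j; first exact: diamond.
  by apply/esym/diamond.
subst j; case/and3P: su => _ lt sv; case/and3P: su' => _ _ sv'.
exact: IH (asc _ lt) sv sv'.
Qed.

Definition partial_propagation n f : fun_space C k := fun x =>
  let u := xget [::] [set u | sorts n x u]%classic in T_word u f (run u x).

Local Notation G := partial_propagation.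

Lemma partial_propagationE n x u f : sorts n x u -> G n f x = T_word u f (run u x).
Proof.
move=> su; rewrite /G; case: xgetP => [v _ sv|/(_ u)//].
exact: T_word_sorts sv su.
Qed.

Lemma G_chamber n f x : chamber n x -> G n f x = f x.
Proof. by move=> ch; rewrite (@partial_propagationE _ _ [::]). Qed.

Lemma G_ascent n i f x : (i.+1 < n)%N -> x (lft i) 0 < x (rgt i) 0 ->
  G n f x = G n (T i f) (s_ i x).
Proof.
move=> i_n lt; have [u su] := sorts_exists n (s_ i x).
rewrite (partial_propagationE _ su) (@partial_propagationE _ _ (i :: u)) //=.
by rewrite i_n lt.
Qed.

(** The hypothesis covers every point with fewer inversions, not just [s_i x]: the braid case of
    [G_wall] makes two swaps before using it. *)
Lemma sort_ind n (P : lattice k -> Prop) :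
  (forall x, chamber n x -> P x) ->
  (forall x i, (i.+1 < n)%N -> x (lft i) 0 < x (rgt i) 0 ->
    (forall y, (inversions y < inversions x)%N -> P y) -> P x) ->
  forall x, P x.
Proof.
move=> P0 PS x; have [m] := ubnP (inversions x); elim: m x => // m IH x lem.
case: (boolP (chamber n x)) => [/P0 //|/chamberPn[i i_n lt]].
by apply: PS i_n lt _ => y lty; apply: IH; lia.
Qed.

(** A far ascent [j] commutes with [T i]. A neighbouring one is followed by an ascent at [i]; after
    both swaps the pair of equal coordinates sits at [j], and the braid relation turns [T i] into a
    [T j] that the induction hypothesis absorbs. *)
Lemma G_wall n i f x : (i.+1 < n)%N -> x (lft i) 0 = x (rgt i) 0 ->
  G n (T i f) x = G n f x.
Proof.
move: x i f; apply: (sort_ind (n := n)) => [x ch i f _ e|x j j_n lt IH i f i_n e].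
  by rewrite !G_chamber ?T_wall.
have lt1 := inversions_ascent lt.
rewrite (G_ascent _ j_n lt) [RHS](G_ascent _ j_n lt).
have far_lt : ((i.+1 < j) || (j.+1 < i))%N -> G n (T j (T i f)) (s_ j x) = G n (T j f) (s_ j x).
  move=> far; have -> : T j (T i f) = T i (T j f).
    by case/orP: far => far; rewrite (T_comm _ far).
  apply: IH i_n _; first by rewrite lt1.
  by case/orP: far => far; [have [-> ->] := swap_far' x far|have [-> ->] := swap_far x far].
have [ij|ij|eij] := ltngtP i j; last by rewrite -(ord_inj eij) e ltxx in lt.
- have [|le] := boolP (i.+1 < j)%N; first by move=> far; apply: far_lt; rewrite far.
  have ji : j = i.+1 :> nat by lia.
  have [lj ei ej _] := swap_next x ji; have [_ eij _ _] := swap_next (s_ j x) ji.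
  have lt2 : (s_ j x) (lft i) 0 < (s_ j x) (rgt i) 0 by rewrite !ej e -lj.
  rewrite (G_ascent _ i_n lt2) [RHS](G_ascent _ i_n lt2) (T_braid _ ji).
  apply: IH j_n _; first by rewrite lt1 (inversions_ascent lt2).
  by rewrite lj !eij !ej e.
have [|le] := boolP (j.+1 < i)%N; first by move=> far; apply: far_lt; rewrite far orbT.
have ji : i = j.+1 :> nat by lia.
have [lj ei ej _] := swap_next x ji; have [_ _ eij _] := swap_next (s_ j x) ji.
have lt2 : (s_ j x) (lft i) 0 < (s_ j x) (rgt i) 0.
  by rewrite lj !ei -e lj.
rewrite (G_ascent _ i_n lt2) [RHS](G_ascent _ i_n lt2) -(T_braid _ ji).
apply: IH j_n _; first by rewrite lt1 (inversions_ascent lt2).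
by rewrite !eij !ei -e lj.
Qed.

Lemma G_le n i f x : (i.+1 < n)%N -> x (lft i) 0 <= x (rgt i) 0 ->
  G n f x = G n (T i f) (s_ i x).
Proof.
move=> i_n; rewrite le_eqVlt => /orP[/eqP e|]; last exact: G_ascent.
by rewrite G_wall ?simple_refl_id // !simple_refl_entry swap_posL swap_posR.
Qed.

(** For [n <= i] every letter sorting the first [n] positions is far from [i], so [T i] commutes
    with the whole propagation and acts as on plain functions. *)
Lemma G_outer_wall n i f x : (n <= i)%N -> x (lft i) 0 = x (rgt i) 0 ->
  G n (T i f) x = G n f x.
Proof.
move=> i_n; move: x f; apply: (sort_ind (n := n)) => [x ch f e|x j j_n lt IH f e].
  by rewrite !G_chamber ?T_wall.
have ji : (j.+1 < i)%N by lia.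
rewrite (G_ascent _ j_n lt) [RHS](G_ascent _ j_n lt) (T_comm _ ji).
apply: IH; first by rewrite (inversions_ascent lt).
by have [-> ->] := swap_far x ji.
Qed.

Lemma chamber_outer n x y : (forall p, (p < n)%N -> x p 0 = y p 0) ->
  chamber n x -> chamber n y.
Proof.
move=> xy /forallP ch; apply/forallP => i; apply/implyP => i_n.
by have /implyP/(_ i_n) := ch i; rewrite !xy //= ltnW.
Qed.

Lemma G_outer_adjacent n i f x : (n <= i)%N -> x (lft i) 0 = x (rgt i) 0 + 1 ->
  G n (T i f) x = (1 + beta * gamma) * G n f (s_ i x) + alpha * delta * G n f x
    + alpha * gamma * G n f (x + vbasis_elt (rgt i))
    + beta * delta * G n f (x - vbasis_elt (lft i)).
Proof.
move=> i_n; have out p (q : 'I_k) : (n <= p)%N -> (q < n)%N -> vbasis_elt p q 0 = 0.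
  by move=> np qn; rewrite vbasisE; case: eqP => // qp; rewrite qp ltnNge np in qn.
move: x f; apply: (sort_ind (n := n)) => [x ch f e|x j j_n lt IH f e].
  have chE y : (forall p, (p < n)%N -> y p 0 = x p 0) -> G n f y = f y.
    by move=> yx; apply/G_chamber/(chamber_outer _ ch) => p pn; rewrite yx.
  rewrite G_chamber // T_adjacent // !chE // => p pn.
  - by rewrite mxE [X in _ + X]mxE out /= ?subr0 //.
  - by rewrite mxE out /= ?addr0 //; lia.
  - by rewrite simple_refl_entry swap_pos_far //; lia.
have ji : (j.+1 < i)%N by lia.
have [el er] := swap_far x ji.
have asc y : (forall p, (p < n)%N -> y p 0 = x p 0) ->
    G n f y = G n (T j f) (s_ j y).
  by move=> yx; apply: G_ascent => //; rewrite !yx //= ltnW.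
rewrite (G_ascent _ j_n lt) (T_comm _ ji) IH ?el ?er //; last first.
  by rewrite (inversions_ascent lt).
have sv p : p != j :> nat -> p != j.+1 :> nat ->
    s_ j (vbasis_elt p) = vbasis_elt p :> lattice k.
  by move=> *; rewrite simple_refl_vbasis swap_pos_far.
have vl : s_ j (vbasis_elt (lft i)) = vbasis_elt (lft i) :> lattice k.
  by apply: sv => /=; lia.
have vr : s_ j (vbasis_elt (rgt i)) = vbasis_elt (rgt i) :> lattice k.
  by apply: sv => /=; lia.
rewrite [in RHS](G_ascent _ j_n lt) (asc (s_ i x)); last first.
  by move=> p pn; rewrite simple_refl_entry swap_pos_far //; lia.
rewrite (asc (x + _)); last by move=> p pn; rewrite mxE out /= ?addr0 //; lia.
rewrite (asc (x - _)); last by move=> p pn; rewrite mxE [X in _ + X]mxE out /= ?subr0 //.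
by rewrite (simple_refl_comm _ ji) mulmxDr mulmxBr vl vr.
Qed.

Lemma G_widen n (o : 'I_k) f x : o = n :> nat ->
  (forall p, (p < n)%N -> x o 0 <= x p 0) -> G n.+1 f x = G n f x.
Proof.
move=> on le; have [u su] := sorts_exists n x.
by rewrite (partial_propagationE _ su) (partial_propagationE _ (sorts_widen on le su)).
Qed.

Local Notation qn := (qint alpha beta gamma delta).
Local Notation q := (hecke_q alpha beta gamma delta).

Lemma qintS n : qn n.+1 = 1 + q * qn n.
Proof.
rewrite /qint big_ord_recl expr0 mulr_sumr; congr (_ + _).
by apply: eq_bigr => i _; rewrite -exprS.
Qed.

Lemma qint0 : qn 0 = 0. Proof. exact: big_ord0. Qed.

Lemma addE x p p' : (x + vbasis_elt p) p' 0 = x p' 0 + (p' == p)%:R.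
Proof. by rewrite mxE vbasisE. Qed.

Lemma subE x p p' : (x - vbasis_elt p) p' 0 = x p' 0 - (p' == p)%:R.
Proof. by rewrite mxE [X in _ + X]mxE vbasisE. Qed.

Definition lower_set n (o : 'I_k) x : {set 'I_k} :=
  [set p : 'I_k | (p < n)%N & x p 0 == x o 0 - 1].

Definition card_above (A : {set 'I_k}) p := #|[set p' in A | (p < p')%N]|.

Lemma card_swap i (A B : {set 'I_k}) :
  (forall p, (swap_pos i p \in B) = (p \in A)) -> #|B| = #|A|.
Proof.
move=> AB; rewrite -(card_imset (mem A) (inv_inj (@swap_posK k i))).
apply: eq_card => p; rewrite -{1}(swap_posK i p) AB.
by rewrite -{2}(swap_posK i p) (mem_imset _ _ (inv_inj (@swap_posK k i))).
Qed.

Lemma swap_lt i x p p' : x (lft i) 0 != x (rgt i) 0 -> x p 0 = x p' 0 ->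
  (swap_pos i p < swap_pos i p')%N = (p < p')%N.
Proof.
move=> ne e.
have n1 : ~~ ((p == lft i) && (p' == rgt i)).
  by apply: contra ne => /andP[/eqP <- /eqP <-]; rewrite e.
have n2 : ~~ ((p' == lft i) && (p == rgt i)).
  by apply: contra ne => /andP[/eqP <- /eqP <-]; rewrite e.
move: n1 n2; rewrite -!val_eqE /= !swap_posE.
by do !case: eqP => //=; lia.
Qed.

Lemma lower_set_swap n (o : 'I_k) i x : (i.+1 < n)%N -> o = n :> nat ->
  forall p, (swap_pos i p \in lower_set n o (s_ i x)) = (p \in lower_set n o x).
Proof.
move=> i_n on p; rewrite !inE !simple_refl_entry swap_posK.
rewrite (swap_pos_far (p := o)); try by rewrite on; lia.
by congr (_ && _); rewrite swap_posE; do !case: eqP; lia.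
Qed.

(** Splits a weighted sum into four fixed sums that a final [ring] can treat as unknowns. *)
Lemma sum_combination (I : finType) (D : {set I}) (w F h0 h1 h2 h3 : I -> C)
    (c0 c1 c2 c3 : C) :
  (forall a, a \in D -> F a = w a * (c0 * h0 a + c1 * h1 a + c2 * h2 a + c3 * h3 a)) ->
  \sum_(a in D) F a =
    c0 * (\sum_(a in D) w a * h0 a) + c1 * (\sum_(a in D) w a * h1 a)
    + c2 * (\sum_(a in D) w a * h2 a) + c3 * (\sum_(a in D) w a * h3 a).
Proof.
move=> FE; rewrite !mulr_sumr -!big_split /=; apply: eq_bigr => a aD.
by rewrite FE //; ring.
Qed.

(** The expansion of [G n.+1 f x] into values of [G n f], where [o] is position [n] and [D] stands
    for the positions one below it. *)
Definition insertion n (o : 'I_k) f x (D : {set 'I_k}) : C :=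
  (1 + beta * gamma * qn #|D|) * G n f x
  + beta * delta * qn #|D| * G n f (x - vbasis_elt o)
  + \sum_(p in D) q ^+ card_above D p *
      (alpha * gamma * G n f (x + vbasis_elt p)
       + alpha * delta * G n f (x + vbasis_elt p - vbasis_elt o)).

Lemma insertion0 n (o : 'I_k) f x : insertion n o f x set0 = G n f x.
Proof.
by rewrite /insertion big_set0 cards0 qint0 !mulr0 !addr0 mul0r mul1r addr0.
Qed.

Lemma lower_set_eq0 n (o : 'I_k) x : (forall p, (p < n)%N -> x o 0 <= x p 0) ->
  lower_set n o x = set0.
Proof.
move=> le; apply/setP => p; rewrite !inE; apply/negbTE/negP => /andP[/le + /eqP e].
by rewrite e; lia.
Qed.

(** Induction on [n], then on the sorting of the first [n] coordinates, whose ascents transform both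
    sides alike. At a sorted prefix, [o] is swapped past its left neighbour [o'], and the hypothesis
    at [n'] applies to [T i f]; there [T i] acts beyond the prefix, so the outer wall and adjacency
    rules remove it. The right-hand side is also reduced to [G n'], and the two are compared. *)
Lemma G_insert n (o : 'I_k) f x : o = n :> nat ->
  (forall p, (p < n)%N -> x o 0 - 1 <= x p 0) ->
  G n.+1 f x = insertion n o f x (lower_set n o x).
Proof.
elim: n o f x => [|n' IHn] o f x.
  by move=> on _; rewrite (G_widen _ on) ?lower_set_eq0 ?insertion0.
have [n nE] : exists n, n = n'.+1 by exists n'.+1.
rewrite -nE => on; move: x f; apply: (sort_ind (n := n)); last first.
  move=> x i i_n lt IH f le.
  have so : (s_ i x) o 0 = x o 0.
    by rewrite simple_refl_entry swap_pos_far //; rewrite on; lia.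
  have lowS := lower_set_swap x i_n on.
  rewrite (G_ascent _ (leqW i_n) lt) IH ?(inversions_ascent lt) //; last first.
    move=> p pn; rewrite so simple_refl_entry le //.
    by rewrite swap_posE; do !case: eqP; lia.
  have sv : s_ i (vbasis_elt o) = vbasis_elt o :> lattice k.
    by rewrite simple_refl_vbasis swap_pos_far // on; lia.
  have ol : lft i != o by rewrite -val_eqE /= on; lia.
  have or : rgt i != o by rewrite -val_eqE /= on; lia.
  rewrite /insertion (card_swap lowS) -(G_ascent _ i_n lt).
  have -> : G n (T i f) (s_ i x - vbasis_elt o) = G n f (x - vbasis_elt o).
    by rewrite -{1}sv -mulmxBr -G_ascent // !subE !(negPf ol, negPf or) !subr0.
  congr (_ + _); rewrite (reindex_inj (inv_inj (@swap_posK k i))).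
  apply: eq_big => p //; rewrite lowS => pD; congr (_ ^+ _ * _).
    apply: (@card_swap i) => p'; rewrite inE [RHS]inE lowS.
    apply: andb_id2l => p'D; apply: (@swap_lt _ x); first by rewrite lt_eqF.
    by move: pD p'D; rewrite !inE => /andP[_ /eqP ->] /andP[_ /eqP ->].
  have svp : vbasis_elt (swap_pos i p) = s_ i (vbasis_elt p) :> lattice k.
    by rewrite simple_refl_vbasis.
  have lep : (x + vbasis_elt p) (lft i) 0 <= (x + vbasis_elt p) (rgt i) 0.
    rewrite !addE; move: pD; rewrite inE => /andP[_ /eqP pv].
    have := le (lft i) (ltnW i_n); case: (rgt i =P p) => [rp|_].
      by move: lt; rewrite rp pv; lia.
    by case: eqP; lia.
  rewrite svp -{1}sv -mulmxDr -mulmxBr -!G_le // !subE !(negPf ol, negPf or) !subr0.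
  exact: lep.
move=> x ch f le.
have n'k : (n' < k.-1)%N by have := ltn_ord o; rewrite on nE; lia.
pose i : 'I_k.-1 := Ordinal n'k; pose o' := lft i.
have ro : rgt i = o by apply: ord_inj; rewrite on nE.
have in_n p : (p < n)%N -> x o' 0 <= x p 0.
  by move=> pn; apply: (chamber_le ch) => /=; lia.
(* The prefix is sorted, so [o'] carries its minimum: either nothing lies below [o], or [o'] is
   exactly one below it. *)
have [lo|lt] := lerP (x o 0) (x o' 0).
  rewrite (G_widen _ on) ?lower_set_eq0 ?insertion0 // => p /in_n.
    exact: le_trans.
  exact: le_trans.
have xo' : x o' 0 = x o 0 - 1 by have := le o'; rewrite /= nE => /(_ (ltnSn _)); lia.
have o'o : o != o'.
  by apply/eqP => /(congr1 (@nat_of_ord k)); rewrite on nE /=; lia.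
have asc : x (lft i) 0 < x (rgt i) 0 by rewrite ro.
rewrite (@G_ascent _ i) //; last by rewrite /= nE.
set y := s_ i x.
have yE : y = x + vbasis_elt o' - vbasis_elt o.
  rewrite /y simple_reflE alpha_rootE ro -/o' xo' /simple_coroot ro -/o'.
  by apply/matrixP => a b; rewrite !mxE; ring.
have yo : y o 0 = x o 0 - 1.
  by rewrite yE subE addE eqxx (negPf o'o) addr0.
have yo' : y o' 0 = x o 0.
  by rewrite yE subE addE eqxx eq_sym (negPf o'o) subr0 xo' subrK.
have ne p : (p < n')%N -> (p != o) && (p != o').
  by move=> pn; rewrite -!val_eqE; move: pn on; rewrite /= nE; lia.
have yp p : (p < n')%N -> y p 0 = x p 0.
  by case/ne/andP => /negPf po /negPf po'; rewrite yE subE addE po po' addr0 subr0.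
set D' := lower_set n' o' y.
have D'n p : p \in D' -> (p < n')%N by rewrite inE => /andP[].
have o'D' : o' \notin D' by rewrite inE /= ltnn.
have DE : lower_set n o x = o' |: D'.
  apply/setP => p; rewrite !inE yo' nE.
  have [->|po'] /= := eqVneq p o'; first by rewrite xo' eqxx /= ltnSn.
  have -> : (p < n'.+1)%N = (p < n')%N.
    by move: po'; rewrite -val_eqE /=; lia.
  by case pn: (p < n')%N => //=; rewrite yp.
(* If [o'] is raised to the height of [o], the positions [D'] are one below it and the induction
   hypothesis applies. *)
have insE g (z : lattice k) : z o' 0 = x o 0 -> (forall p, (p < n')%N -> z p 0 = x p 0) ->
    G n g z = insertion n' o' g z D'.
  move=> zo' zp; rewrite nE (IHn o') //; last by move=> p pn; rewrite zo' zp // le // nE ltnW.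
  congr insertion; apply/setP => p; rewrite !inE zo' yo'.
  by case pn: (p < n')%N => //=; rewrite zp ?yp.
(* If [o'] keeps its height it remains minimal, and inserting it costs nothing. *)
have widE (z : lattice k) : z o' 0 = x o' 0 -> (forall p, (p < n')%N -> x p 0 <= z p 0) ->
    G n f z = G n' f z.
  move=> zo' zp; rewrite nE (@G_widen n' o') // => p pn.
  by rewrite zo'; apply: le_trans (zp p pn); apply: in_n; rewrite nE ltnW.
have -> : G n.+1 (T i f) y = insertion n' o' (T i f) y D'.
  rewrite (G_widen _ on) ?insE // => p; rewrite yo nE ltnS leq_eqVlt => /orP[/eqP pn'|pn].
    have -> : p = o' by apply: ord_inj.
    by rewrite yo'; lia.
  by rewrite yp // le // nE ltnW.
have o'o_ : (o' == o) = false by rewrite eq_sym (negPf o'o).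
have adj (z : lattice k) : z o' 0 = z o 0 + 1 -> G n' (T i f) z =
    (1 + beta * gamma) * G n' f (z - vbasis_elt o' + vbasis_elt o)
    + alpha * delta * G n' f z + alpha * gamma * G n' f (z + vbasis_elt o)
    + beta * delta * G n' f (z - vbasis_elt o').
  rewrite -ro => zo; rewrite G_outer_adjacent //; congr (_ * G n' f _ + _ + _ + _).
  rewrite simple_reflE alpha_rootE zo /simple_coroot.
  by apply/matrixP => a b; rewrite !mxE; ring.
have wal (z : lattice k) : z o' 0 = z o 0 -> G n' (T i f) z = G n' f z.
  by rewrite -ro => zo; rewrite G_outer_wall.
rewrite DE /insertion cardsU1 o'D' add1n qintS big_setU1 //=.
have -> : card_above (o' |: D') o' = 0%N.
  apply: eq_card0 => p; rewrite !inE; apply/negbTE/negP => /andP[/orP[/eqP ->|]].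
    by rewrite ltnn.
  by case/andP => /= pn _; rewrite ltnNge ltnW.
rewrite expr0 mul1r (widE x) // (widE (x - _)); last 2 first.
- by rewrite subE o'o_ subr0.
- by move=> p /ne/andP[/negPf po _]; rewrite subE po subr0.
rewrite (insE f (x + _)); last 2 first.
- by rewrite addE eqxx xo' subrK.
- by move=> p /ne/andP[_ /negPf po]; rewrite addE po addr0.
rewrite -yE (insE f y) // adj; last by rewrite yo yo' subrK.
rewrite wal; last by rewrite !subE eqxx (negPf o'o) yo yo' subr0.
have e1 : y - vbasis_elt o' + vbasis_elt o = x.
  by rewrite yE; apply/matrixP => a b; rewrite !mxE; ring.
have e2 : y + vbasis_elt o = x + vbasis_elt o' by rewrite yE subrK.
have e3 : y - vbasis_elt o' = x - vbasis_elt o.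
  by rewrite yE; apply/matrixP => a b; rewrite !mxE; ring.
have e4 : x + vbasis_elt o' - vbasis_elt o' = x by rewrite addrK.
rewrite e1 e2 e3 /insertion e3 e4.
move: (G n' (T i f)) (G n f) (G n' f) adj wal widE => gT gn g adj wal widE.
(* Names the values of [g] at the four kinds of shifted points as functions of [p], so that every
   sum over [D'] takes the form of [sum_combination]. *)
have lift_ (z : 'I_k -> lattice k) : exists h : 'I_k -> C, forall p, g (z p) = h p.
  by exists (fun p => g (z p)).
have [h0 /= h0E] := lift_ (fun p => x + vbasis_elt p).
have [h1 /= h1E] := lift_ (fun p => x + vbasis_elt p - vbasis_elt o).
have [h2 /= h2E] := lift_ (fun p => x + vbasis_elt o' + vbasis_elt p).
have [h3 /= h3E] := lift_ (fun p => y + vbasis_elt p).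
have S_E F c0 c1 c2 c3 := @sum_combination _ D' (fun p => q ^+ card_above D' p)
  F h0 h1 h2 h3 c0 c1 c2 c3.
rewrite (S_E _ (alpha * gamma * (1 + beta * gamma))
    (alpha * gamma * beta * delta + alpha * delta) (alpha * gamma * (alpha * gamma))
    (alpha * gamma * (alpha * delta))); last first.
  move=> p pD'; have /andP[/negPf po /negPf po'] := ne p (D'n p pD').
  rewrite adj; last by rewrite !addE ![_ == p]eq_sym po po' !addr0 yo yo' subrK.
  rewrite wal; last first.
    by rewrite !subE !addE ![_ == p]eq_sym po po' eqxx (negPf o'o) yo yo' !addr0 ?subr0.
  have -> : y + vbasis_elt p - vbasis_elt o' + vbasis_elt o = x + vbasis_elt p.
    by rewrite yE; apply/matrixP => a b; rewrite !mxE; ring.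
  have -> : y + vbasis_elt p + vbasis_elt o = x + vbasis_elt o' + vbasis_elt p.
    by rewrite yE; apply/matrixP => a b; rewrite !mxE; ring.
  have -> : y + vbasis_elt p - vbasis_elt o' = x + vbasis_elt p - vbasis_elt o.
    by rewrite yE; apply/matrixP => a b; rewrite !mxE; ring.
  transitivity (q ^+ card_above D' p * (alpha * gamma *
    ((1 + beta * gamma) * h0 p + alpha * delta * h3 p + alpha * gamma * h2 p
     + beta * delta * h1 p) + alpha * delta * h1 p)); last by move: (q ^+ card_above D' p) => w; ring.
  by rewrite -h0E -h1E -h2E -h3E.
rewrite (S_E (fun p => _ ^+ _ * (_ * _ + _ * g (x + vbasis_elt o' + vbasis_elt p - vbasis_elt o')))
    (alpha * delta) 0 (alpha * gamma) 0); last first.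
  move=> p pD'; transitivity (q ^+ card_above D' p *
    (alpha * gamma * h2 p + alpha * delta * h0 p)); last by move: (q ^+ card_above D' p) => w; ring.
  by rewrite -h0E -h2E; congr (_ * (_ + _ * g _)); rewrite addrAC addrK.
rewrite (S_E (fun p => _ ^+ _ * (_ * _ + _ * g (y + vbasis_elt p - vbasis_elt o')))
    0 (alpha * delta) 0 (alpha * gamma)); last first.
  move=> p pD'; transitivity (q ^+ card_above D' p *
    (alpha * gamma * h3 p + alpha * delta * h1 p)); last by move: (q ^+ card_above D' p) => w; ring.
  by rewrite -h1E -h3E; congr (_ * (_ + _ * g _)); rewrite addrAC e3 addrAC.
rewrite (S_E (fun p => _ * (_ * gn (_ + vbasis_elt p) + _))
    (q * (alpha * gamma)) (q * (alpha * delta)) 0 0); last first.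
  move=> p pD'; have pn := D'n p pD'; have /andP[/negPf po /negPf po'] := ne p pn.
  have -> : card_above (o' |: D') p = (card_above D' p).+1.
    rewrite /card_above (_ : [set _ in _ | _] = o' |: [set p' in D' | (p < p')%N]).
      by rewrite cardsU1 !inE /= ltnn.
    by apply/setP => p'; rewrite !inE; case: eqP => [->|] //=; rewrite pn.
  rewrite exprS (widE (x + _)); last 2 first.
  - by rewrite addE eq_sym po' addr0.
  - by move=> p' _; rewrite addE lerDl.
  rewrite (widE (x + _ - _)); last 2 first.
  - by rewrite subE addE eq_sym po' o'o_ addr0 subr0.
  - by move=> p' /ne/andP[/negPf p'o _]; rewrite subE addE p'o subr0 lerDl.
  transitivity (q * q ^+ card_above D' p *
    (alpha * gamma * h0 p + alpha * delta * h1 p)); last by move: (q ^+ card_above D' p) => w; ring.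
  by rewrite -h0E -h1E.
move: (g x) (g y) (g (x - _)) (g (x + _)) => a0 a1 a2 a3.
(* The value [q = 1 + beta * gamma - alpha * delta] enters here: it balances the weight of the
   positions in [D'], raised by one through the extra element [o'] above them. *)
do 4!move: (\sum_(p in D') _) => ?; rewrite /hecke_q; ring.
Qed.

End PartialPropagation.

(** * The identity in a block of equal coordinates *)

Section BlockIdentity.
Variables (C : fieldType) (k : nat) (alpha beta gamma delta : C).

Local Notation qn := (qint alpha beta gamma delta).
Local Notation qf := (qfact alpha beta gamma delta).
Local Notation q := (hecke_q alpha beta gamma delta).

(** The element [o] preceded by all others has rank [#|D| - 1], and removing it leaves the other
    ranks unchanged; hence each rank from 0 to [#|D| - 1] occurs once. *)
Lemma sum_rank (I : finType) (r : rel I) (g : nat -> C) (D : {set I}) :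
  irreflexive r ->
  (forall D : {set I}, D != set0 -> exists2 o, o \in D &
     forall p, p \in D -> p != o -> r p o && ~~ r o p) ->
  \sum_(j in D) g #|[set p in D | r p j]| = \sum_(t < #|D|) g t.
Proof.
move=> irr top; have [n] := ubnP #|D|; elim: n D => // n IH D.
have [->|D0] := eqVneq D set0; first by rewrite cards0 big_set0 big_ord0.
have [o oD oP] := top _ D0; rewrite (cardsD1 o D) oD ltnS => le.
have DE : D = o |: D :\ o by rewrite setD1K.
rewrite big_ord_recr /= -IH // (big_setD1 o) //= addrC; congr (_ + g _).
  apply: eq_bigr => j jD; congr g; apply: eq_card => p; rewrite !inE.
  case: eqVneq => //= ->; move: jD; rewrite !inE => /andP[jo jD].
  by have /andP[_ /negPf ->] := oP j jD jo; rewrite andbF.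
apply: eq_card => p; rewrite !inE; case: eqVneq => [->|po] /=.
  by rewrite irr andbF.
by case pD: (p \in D) => //=; have /andP[->] := oP p pD po.
Qed.

Definition card_below (A : {set 'I_k}) (p : 'I_k) := #|[set p' in A | (p' < p)%N]|.

Lemma sum_rank_below (g : nat -> C) (D : {set 'I_k}) :
  \sum_(j in D) g (card_below D j) = \sum_(t < #|D|) g t.
Proof.
apply: (@sum_rank _ (fun p p' : 'I_k => p < p')%N) => [p|A /set0Pn[a aA]].
  exact: ltnn.
have [o oA oP] := @arg_maxnP _ a (mem A) (@nat_of_ord k) aA.
exists o => // p pA po; have le : (p <= o)%N := oP p pA.
rewrite -leqNgt le andbT ltn_neqAle le andbT.
by rewrite val_eqE.
Qed.

Lemma sum_rank_above (g : nat -> C) (D : {set 'I_k}) :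
  \sum_(j in D) g (card_above D j) = \sum_(t < #|D|) g t.
Proof.
apply: (@sum_rank _ (fun p p' : 'I_k => p' < p)%N) => [p|A /set0Pn[a aA]].
  exact: ltnn.
have [o oA oP] := @arg_minnP _ a (mem A) (@nat_of_ord k) aA.
exists o => // p pA po; have le : (o <= p)%N := oP p pA.
rewrite -leqNgt le andbT ltn_neqAle le andbT.
by rewrite eq_sym val_eqE.
Qed.

Hypothesis q0 : q != 0.
Hypothesis qn_neq0 : forall n, (0 < n)%N -> 1 + beta * gamma * qn n != 0.

Lemma one_qn_neq0 n : 1 + beta * gamma * qn n != 0.
Proof. by case: n => [|n]; [rewrite qint0 mulr0 addr0 oner_neq0|exact: qn_neq0]. Qed.

Lemma expq_qint n : q ^+ n = 1 + (q - 1) * qn n.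
Proof.
elim: n => [|n IH]; first by rewrite qint0 mulr0 addr0.
by rewrite exprS qintS IH; ring.
Qed.

(** Stated without division by [q - 1], so that [q = 1] is included. *)
Lemma qint_add m n : qn (m + n) = qn m + qn n + (q - 1) * qn m * qn n.
Proof.
elim: m => [|m IH]; first by rewrite qint0 add0n; ring.
by rewrite addSn !qintS IH; ring.
Qed.

Lemma qfactS n : qf n.+1 = qf n * qn n.+1.
Proof. by rewrite /qfact big_nat_recr. Qed.

(* The coefficient of an (r+1)-fold product of shifts at a block of d+1 equal
   coordinates. *)
Definition block_coef d r : C :=
  (- (beta * delta)) ^+ r * qf r / q ^+ (r.+1 * r)./2
  / \prod_(p < r.+1) (1 + beta * gamma * qn (d - p)%N).

Lemma block_coef0 d : block_coef d 0 = (1 + beta * gamma * qn d)^-1.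
Proof.
by rewrite /block_coef big_ord1 subn0 muln0 /qfact big_geq //= !expr0 invr1 !mul1r.
Qed.

(** Three neighbouring coefficients over one common denominator [P], which turns the recurrences
    below into identities that [field] decides. *)
Lemma block_coefS n s : exists N P : C,
  [/\ P != 0,
      block_coef (n + s.+1) s = N * (1 + beta * gamma * qn n) / P,
      block_coef (n + s.+1) s.+1
        = N * (- (beta * delta) * qn s.+1 / q ^+ s.+1) / P
    & block_coef (n + s) s = N * (1 + beta * gamma * qn (n + s.+1)) / P].
Proof.
pose N := (- (beta * delta)) ^+ s * qf s / q ^+ (s.+1 * s)./2.
pose P := \prod_(p < s.+2) (1 + beta * gamma * qn ((n + s.+1) - p)%N).
exists N, P.
have P0 : P != 0 by apply/prodf_neq0 => p _; apply: one_qn_neq0.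
have P1 : \prod_(p < s.+1) (1 + beta * gamma * qn ((n + s.+1) - p)%N)
    = P / (1 + beta * gamma * qn n).
  by rewrite /P [in RHS]big_ord_recr /= addnK mulfK // one_qn_neq0.
have P2 : \prod_(p < s.+1) (1 + beta * gamma * qn ((n + s) - p)%N)
    = P / (1 + beta * gamma * qn (n + s.+1)).
  rewrite /P [in RHS]big_ord_recl /= subn0 [X in _ = X / _]mulrC mulfK ?one_qn_neq0 //.
  by apply: eq_bigr => p _; rewrite /bump /= addnS subSS.
split=> //.
- by rewrite /block_coef P1 -/N invf_div mulrA.
- rewrite /block_coef -/P qfactS exprS.
  have -> : (s.+2 * s.+1)./2 = ((s.+1 * s)./2 + s.+1)%N.
    have -> : (s.+2 * s.+1 = s.+1 * s + s.+1.*2)%N by rewrite -muln2; nia.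
    by rewrite halfD odd_double andbF add0n doubleK.
  rewrite exprD /N.
  have := expf_neq0 s.+1 q0; have := expf_neq0 (s.+1 * s)./2 q0.
  move: (q ^+ _) (q ^+ _) ((- _) ^+ s) => a b c a0 b0; field.
  by rewrite a0 b0 P0.
- by rewrite /block_coef P2 -/N invf_div mulrA.
Qed.

(** Compares the coefficients of [E1 A] in [block_identity], for [#|A| = s.+1]. *)
Lemma block_coef_rec m s : (s < m)%N ->
  block_coef m s * (1 + beta * gamma * qn s.+1)
  + block_coef m s.+1 * q ^+ s.+1 * qn (m - s.+1) * (alpha * gamma)
  = block_coef m.-1 s.
Proof.
move=> sm; have -> : m = (m - s.+1 + s.+1)%N by rewrite subnK.
move: (m - s.+1)%N => n; rewrite addnK addnS /=.
have [N [P [P0 e1 e2 e3]]] := block_coefS n s; rewrite -addnS e1 e2 e3.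
rewrite qint_add; have := expf_neq0 s.+1 q0.
move: (q ^+ _) => a a0; rewrite /hecke_q; field.
by rewrite a0 P0.
Qed.

(** Makes the terms in [E2 A] of [block_identity] cancel, for [#|A| = s.+1]. *)
Lemma block_coef_cancel m s : (s < m)%N ->
  block_coef m s * (beta * delta * qn s.+1)
  + block_coef m s.+1 * (q ^+ s.+1 * qn (m - s.+1) * (alpha * delta) + q ^+ m) = 0.
Proof.
move=> sm; have -> : m = (m - s.+1 + s.+1)%N by rewrite subnK.
move: (m - s.+1)%N => n; rewrite addnK.
have [N [P [P0 e1 e2 e3]]] := block_coefS n s; rewrite e1 e2.
rewrite exprD (expq_qint n); have := expf_neq0 s.+1 q0.
move: (q ^+ _) => a a0; rewrite /hecke_q; field.
by rewrite a0 P0.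
Qed.

Definition weight (B A : {set 'I_k}) : nat := \sum_(j in A) card_below B j.

(** The elements of [A] below [j] and above [j] exhaust [A], so the exponent is [#|A|] plus the rank
    of [j] in [B :\: A]; summing over the ranks gives a q-integer. *)
Lemma sum_insertion_weights (A B : {set 'I_k}) : A \subset B ->
  \sum_(j in B :\: A) q ^+ (card_below B j + card_above A j)
  = q ^+ #|A| * qn (#|B| - #|A|).
Proof.
move=> AB; rewrite -(setIidPr AB) -cardsD (setIidPr AB) /qint.
rewrite -(sum_rank_below (fun t => q ^+ t)) mulr_sumr; apply: eq_bigr => j.
rewrite inE => /andP[jA jB]; rewrite -exprD; congr (_ ^+ _).
have -> : card_below B j = (card_below A j + card_below (B :\: A) j)%N.
  rewrite /card_below -(cardsID A); congr (_ + _)%N; apply: eq_card => p; rewrite !inE.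
    by case pA: (p \in A); rewrite ?andbF // (fintype.subsetP AB) ?andbT.
  by case: (p \in A); rewrite ?andbF //= andbT.
rewrite addnAC; congr (_ + _)%N.
rewrite /card_below /card_above -(cardsID [set p : 'I_k | (p < j)%N] A).
congr (_ + _)%N; apply: eq_card => p; rewrite !inE // -leqNgt.
rewrite [RHS]andbC; case pA: (p \in A); rewrite ?andbF //=.
by case: (ltngtP j p) => // /ord_inj e; rewrite e pA in jA.
Qed.

(** Pairs of a set and one of its elements correspond to pairs of the smaller set and the element to
    be added. *)
Lemma sum_remove_exchange (B : {set 'I_k}) (F : {set 'I_k} -> 'I_k -> C) :
  \sum_(A : {set 'I_k} | (A \subset B) && (A != set0)) \sum_(j in A) F A j
  = \sum_(A : {set 'I_k} | A \subset B) \sum_(j in B :\: A) F (j |: A) j.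
Proof.
rewrite (exchange_big_dep predT) //= [RHS](exchange_big_dep predT) //=.
apply: eq_bigr => j _.
rewrite (reindex_onto (fun A => j |: A) (fun A => A :\ j)) /=.
  apply: eq_bigl => A; rewrite subUset sub1set !inE eqxx /=.
  have -> : (j |: A != set0) by apply/set0Pn; exists j; rewrite !inE eqxx.
  rewrite !andbT [RHS]andbC -andbA; case: (j \in B) => //=; last by rewrite ?andbF.
  rewrite andbC; congr (_ && _); apply/eqP/idP => [<-|jA].
    by rewrite !inE eqxx.
  by rewrite setU1K //; case/andP: jA.
by move=> A /andP[_ jA]; rewrite setD1K.
Qed.

(** In the application [o] is a new position, [B] the earlier positions of equal height, [E1 A] the
    value shifted by [A], and [E2 A] the value shifted by [A] and [o]. The left side collects the
    sets avoiding [o], expanded by insertion, the sets containing [o], and the new constant term.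
    The proof compares the coefficients of each [E1 A] and [E2 A]. *)
Lemma block_identity (B : {set 'I_k}) (E1 E2 : {set 'I_k} -> C) (m := #|B|) :
  \sum_(A : {set 'I_k} | (A \subset B) && (A != set0))
     block_coef m #|A|.-1 * q ^+ weight B A *
     ((1 + beta * gamma * qn #|A|) * E1 A + beta * delta * qn #|A| * E2 A
      + \sum_(j in A) q ^+ card_above A j *
          (alpha * gamma * E1 (A :\ j) + alpha * delta * E2 (A :\ j)))
  + \sum_(A : {set 'I_k} | A \subset B)
      block_coef m #|A| * q ^+ (weight B A + m) * E2 A
  - alpha * gamma * (qn m / (1 + beta * gamma * qn m)) * E1 set0
  = E2 set0 + \sum_(A : {set 'I_k} | (A \subset B) && (A != set0))
      block_coef m.-1 #|A|.-1 * q ^+ weight B A * E1 A.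
Proof.
under eq_bigr => A _ do rewrite mulrDr mulr_sumr.
rewrite big_split /= sum_remove_exchange.
have -> : \sum_(A : {set 'I_k} | A \subset B) \sum_(j in B :\: A)
     (block_coef m #|j |: A|.-1 * q ^+ weight B (j |: A)
      * (q ^+ card_above (j |: A) j
      * (alpha * gamma * E1 ((j |: A) :\ j) + alpha * delta * E2 ((j |: A) :\ j))))
  = \sum_(A : {set 'I_k} | A \subset B) block_coef m #|A| * q ^+ weight B A *
      (q ^+ #|A| * qn (m - #|A|)) * (alpha * gamma * E1 A + alpha * delta * E2 A).
  apply: eq_bigr => A AB; rewrite -sum_insertion_weights // mulr_sumr mulr_suml.
  apply: eq_bigr => j; rewrite inE => /andP[jA jB].
  rewrite setU1K // cardsU1 jA /= /weight big_setU1 //= -/(weight B A).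
  have -> : card_above (j |: A) j = card_above A j.
    apply: eq_card => p; rewrite !inE; case: eqVneq => //= ->.
    by rewrite ltnn andbF.
  rewrite !exprD.
  by move: (q ^+ _) (q ^+ _) (q ^+ _) => a b c; ring.
rewrite ![\sum_(A : {set 'I_k} | A \subset B) _](bigD1 set0) ?sub0set //=.
rewrite cards0 subn0 block_coef0 /weight !big_set0 add0n expr0.
rewrite !mul1r.
pose R (F : {set 'I_k} -> C) := \sum_(A : {set 'I_k} | (A \subset B) && (A != set0)) F A.
have RE : R (fun A => block_coef m #|A|.-1 * q ^+ weight B A *
      ((1 + beta * gamma * qn #|A|) * E1 A + beta * delta * qn #|A| * E2 A))
    + R (fun A => block_coef m #|A| * q ^+ weight B A *
      (q ^+ #|A| * qn (m - #|A|)) * (alpha * gamma * E1 A + alpha * delta * E2 A))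
    + R (fun A => block_coef m #|A| * q ^+ (weight B A + m) * E2 A)
    = R (fun A => block_coef m.-1 #|A|.-1 * q ^+ weight B A * E1 A).
  rewrite /R -!big_split /=; apply: eq_bigr => A /andP[AB A0].
  have : (0 < #|A| <= m)%N by rewrite card_gt0 A0 subset_leq_card.
  case: #|A| => // s sm.
  rewrite -(block_coef_rec sm) exprD; have := block_coef_cancel sm.
  move: (E1 A) (E2 A) (q ^+ weight B A) => a b c e /=.
  apply/eqP; rewrite -subr_eq0 -[X in _ == X](mul0r (c * b)) -e; apply/eqP.
  move: (q ^+ s.+1) (q ^+ m) => u v; ring.
rewrite -[X in _ = _ + X]RE /R {RE R}.
(* Only the empty set remains: [E1 set0] cancels against the constant term, and [E2 set0] gets
   coefficient 1 by the formula for [q ^+ m]. *)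
have d0 := one_qn_neq0 m; have := expq_qint m; move: (q ^+ m) d0 => v d0 ->.
do 3!move: (\sum_(A : {set 'I_k} | _ && _) _) => ?.
rewrite /hecke_q; field.
exact: d0.
Qed.

End BlockIdentity.

(** * The Hamiltonian as a sum over sets *)

Section SetHamiltonian.
Variables (C : fieldType) (k : nat) (alpha beta gamma delta : C).
Implicit Types (x y : lattice k) (i j : 'I_k.-1) (p : 'I_k) (n : nat).
Implicit Types (A B : {set 'I_k}).

Local Notation s_ i x := (simple_refl i *m x).
Local Notation qn := (qint alpha beta gamma delta).
Local Notation q := (hecke_q alpha beta gamma delta).
Local Notation coef := (block_coef alpha beta gamma delta).

Definition vsum A : lattice k := \sum_(j in A) vbasis_elt j.

Definition level x A : bool := [forall i in A, forall j in A, x i 0 == x j 0].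

Definition level_class n x A : {set 'I_k} :=
  [set p : 'I_k | (p < n)%N & [forall j in A, x p 0 == x j 0]].

(** The dependence on [n] is through the size of the block, which counts only positions before
    [n]. *)
Definition set_coef n x A : C :=
  coef #|level_class n x A|.-1 #|A|.-1 * q ^+ (\sum_(j in A) d_minus x j).

Definition const_term d : C := qn d / (1 + beta * gamma * qn d).

Lemma levelP x A : reflect {in A &, forall p p', x p 0 = x p' 0} (level x A).
Proof.
apply: (iffP forall_inP) => [le p p' pA p'A|le p pA].
  by have /forall_inP/(_ p' p'A)/eqP := le p pA.
by apply/forall_inP => p' p'A; apply/eqP/le.
Qed.

Lemma d_minusE x p : d_minus x p = #|[set p' : 'I_k | (p' < p)%N & x p' 0 == x p 0]|.
Proof. by apply: eq_card => p'; rewrite !inE alpha_rootE subr_eq0. Qed.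

Lemma d_plusE x p : d_plus x p = #|[set p' : 'I_k | (p < p')%N & x p' 0 == x p 0]|.
Proof. by apply: eq_card => p'; rewrite !inE alpha_rootE subr_eq0 eq_sym. Qed.

Lemma vsumE A p : vsum A p 0 = (p \in A)%:R.
Proof.
rewrite /vsum summxE; case: (boolP (p \in A)) => pA.
  rewrite (big_setD1 p) //= vbasisE eqxx big1 ?addr0 // => j.
  by rewrite !inE vbasisE eq_sym => /andP[/negPf -> _].
rewrite big1 // => j jA; rewrite vbasisE; case: eqP => // e.
by rewrite e jA in pA.
Qed.

Lemma vsum0 : vsum set0 = 0. Proof. exact: big_set0. Qed.

Lemma sub_vsumE x A p : (x - vsum A) p 0 = x p 0 - (p \in A)%:R.
Proof. by rewrite mxE [X in _ + X]mxE vsumE. Qed.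

Lemma vsum_swap i A : s_ i (vsum A) = vsum (swap_pos i @: A).
Proof.
rewrite /vsum mulmx_sumr big_imset /=; last by move=> p p' _ _ /(inv_inj (@swap_posK k i)).
by apply: eq_bigr => p _; rewrite simple_refl_vbasis.
Qed.

Variable T : 'I_k.-1 -> fun_space C k -> fun_space C k.
Hypothesis T_wall : forall i f x, x (lft i) 0 = x (rgt i) 0 -> T i f x = f x.
Hypothesis T_adjacent : forall i f x, x (lft i) 0 = x (rgt i) 0 + 1 ->
  T i f x = (1 + beta * gamma) * f (s_ i x) + alpha * delta * f x
    + alpha * gamma * f (x + vbasis_elt (rgt i))
    + beta * delta * f (x - vbasis_elt (lft i)).
Hypothesis T_comm : forall i j f, (i.+1 < j)%N -> T i (T j f) = T j (T i f).
Hypothesis T_braid : forall i j f, j = i.+1 :> nat ->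
  T i (T j (T i f)) = T j (T i (T j f)).
Hypothesis q0 : q != 0.
Hypothesis qn_neq0 : forall n, (0 < n)%N -> 1 + beta * gamma * qn n != 0.

Local Notation G := (partial_propagation T).

Lemma chamber_widen m n x : (m <= n)%N -> chamber n x -> chamber m x.
Proof.
move=> mn /forallP ch; apply/forallP => i; apply/implyP => im.
by apply: (implyP (ch i)); apply: leq_trans mn.
Qed.

Definition below n : {set 'I_k} := [set p : 'I_k | (p < n)%N].

Lemma sum_shifts_dominant n y (f : fun_space C k) : chamber k y -> (n <= k)%N ->
  \sum_(p : 'I_k | (p < n)%N) f (y - vbasis_elt p) =
  - (alpha * gamma) * (\sum_(p : 'I_k | (p < n)%N) const_term (d_minus y p)) * f y
  + \sum_(A : {set 'I_k} | [&& A \subset below n, A != set0 & level y A])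
      set_coef n y A * G n f (y - vsum A).
Proof.
move=> ch; elim: n => [|n IH] nk.
  rewrite !big_pred0 ?mulr0 ?mul0r ?addr0 // => A.
  apply/negbTE/negP => /and3P[/fintype.subsetP A0 /set0Pn[p /A0]].
  by rewrite inE.
pose o := Ordinal nk; have on : o = n :> nat by [].
have ltS p : ((p < n.+1)%N && (p != o)) = (p < n)%N.
  by rewrite -val_eqE /=; lia.
rewrite (bigD1 o) //= [\sum_(p < _ | _) const_term _](bigD1 o) //=.
rewrite !(eq_bigl _ _ ltS) IH ?(ltnW nk) // {IH}.
pose B := [set p : 'I_k | (p < n)%N & y p 0 == y o 0].
have mE : d_minus y o = #|B| by rewrite d_minusE.
have yo p : (p < n)%N -> y o 0 <= y p 0.
  by move=> pn; apply: (chamber_le ch); rewrite /= ltnW.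
have Bn : B \subset below n by apply/fintype.subsetP => p; rewrite !inE => /andP[].
have BE p : p \in B -> y p 0 = y o 0 by rewrite inE => /andP[_ /eqP].
have oB : o \notin B by rewrite inE ltnn.
have subB A : A \subset B -> level y A.
  by move=> /fintype.subsetP AB; apply/levelP => p p' /AB/BE -> /AB/BE ->.
pose P2 A := [&& A \subset below n, A != set0 & level y A].
pose P1 A := [&& A \subset below n.+1, A != set0 & level y A].
have P1o A : P1 A && (o \notin A) = P2 A.
  rewrite /P1 /P2; case oA: (o \in A); rewrite ?andbF ?andbT.
    apply/esym/negbTE/negP => /and3P[/fintype.subsetP/(_ o oA)].
    by rewrite inE ltnn.
  congr (_ && _); apply/fintype.subsetP/fintype.subsetP => H p pA; have := H p pA; rewrite !inE.
    rewrite ltnS leq_eqVlt => /orP[/eqP pn|//].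
    by rewrite (_ : o = p) ?pA in oA; last exact: ord_inj.
  exact: leqW.
have P2B A : P2 A && (A \subset B) = (A \subset B) && (A != set0).
  rewrite /P2; case AB: (A \subset B); rewrite ?andbF // andbT (subB _ AB) andbT.
  by rewrite (fintype.subset_trans AB Bn).
pose E1 A := G n f (y - vsum A); pose E2 A := G n f (y - vsum A - vbasis_elt o).
have Bo p : (p \in o |: B) -> y p 0 = y o 0.
  by rewrite !inE => /orP[/eqP -> //|/andP[_ /eqP]].
have class_n A : A \subset B -> A != set0 -> level_class n y A = B.
  move=> /fintype.subsetP AB /set0Pn[a aA]; apply/setP => p; rewrite !inE.
  congr (_ && _); apply/forall_inP/idP => [/(_ a aA)|/eqP e j /AB/BE ->].
    by rewrite (BE a (AB a aA)).
  by rewrite e.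
have class_n1 A : A \subset o |: B -> A != set0 -> level_class n.+1 y A = o |: B.
  move=> /fintype.subsetP AB /set0Pn[a aA]; apply/setP => p; rewrite !inE.
  have -> : [forall j in A, y p 0 == y j 0] = (y p 0 == y o 0).
    apply/forall_inP/idP => [/(_ a aA)|/eqP e j /AB/Bo ->].
      by rewrite (Bo a (AB a aA)).
    by rewrite e.
  have [->|po] := eqVneq p o; first by rewrite eqxx /= ltnSn.
  by rewrite -ltS po andbT.
have wE A : A \subset B -> (\sum_(j in A) d_minus y j)%N = weight B A.
  move=> /fintype.subsetP AB; apply: eq_bigr => j /AB jB; rewrite d_minusE.
  apply: eq_card => p; rewrite !inE (BE _ jB); move: jB; rewrite inE => /andP[jn _].
  by case pj: (p < j)%N; rewrite ?andbF // andbT (ltn_trans pj jn).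
have vE A p : (y - vsum A) p 0 = y p 0 - (p \in A)%:R by exact: sub_vsumE.
have AoB A : P1 (o |: A) -> o \notin A -> A \subset B.
  case/and3P => /fintype.subsetP An _ /levelP lA oA; apply/fintype.subsetP => p pA.
  have pn : (p < n)%N.
    have := An p; rewrite !inE pA orbT => /(_ isT); rewrite -ltS => ->.
    by apply: contra oA => /eqP <-.
  by rewrite inE pn /=; apply/eqP/lA; rewrite !inE ?pA ?eqxx ?orbT.
(* A level set containing [o] is [o] together with a subset of [B]. Lowering [o] makes it minimal,
   so the propagation ignores it. *)
have part1 : \sum_(A | P1 A && (o \in A)) set_coef n.+1 y A * G n.+1 f (y - vsum A)
  = \sum_(A : {set 'I_k} | A \subset B) coef #|B| #|A| * q ^+ (weight B A + #|B|) * E2 A.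
  rewrite (reindex_onto (fun A => o |: A) (fun A => A :\ o)) /=; last first.
    by move=> A /andP[_ oA]; rewrite setD1K.
  apply: eq_big => [A|A /andP[/andP[PA _] /eqP oA]].
    apply/idP/idP => [/andP[/andP[PA _] /eqP oA]|AB].
      by apply: AoB => //; rewrite -oA !inE eqxx.
    have oA : o \notin A by apply: contra oB; apply: (fintype.subsetP AB).
    rewrite setU1K // eqxx setU11 !andbT /P1; apply/and3P; split.
    - rewrite subUset sub1set inE ltnSn /=; apply: (fintype.subset_trans AB).
      by apply: (fintype.subset_trans Bn); apply/fintype.subsetP => p; rewrite !inE => /ltnW.
    - by apply/set0Pn; exists o; rewrite setU11.
    - apply/levelP => p p' pA p'A.
      by rewrite !Bo //; [move: p'A|move: pA]; apply/fintype.subsetP; rewrite setUS.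
  have oA' : o \notin A by rewrite -oA !inE eqxx.
  have AB := AoB A PA oA'.
  rewrite /set_coef class_n1 ?setUS //; last by apply/set0Pn; exists o; rewrite !inE eqxx.
  rewrite !cardsU1 oB oA' !add1n big_setU1 //= wE // mE [(#|B| + _)%N]addnC.
  congr (_ * _).
  rewrite (G_widen T_comm T_braid _ (o := o)) // /E2.
    by congr (G n f _); rewrite /vsum big_setU1 //= opprD addrA addrAC.
  move=> p pn; rewrite !vE !inE eqxx /=; have := yo p pn.
  by case: (_ || _) => /=; lia.
have part2 : \sum_(A | P2 A && (A \subset B)) set_coef n.+1 y A * G n.+1 f (y - vsum A)
  = \sum_(A : {set 'I_k} | (A \subset B) && (A != set0))
     coef #|B| #|A|.-1 * q ^+ weight B A *
     ((1 + beta * gamma * qn #|A|) * E1 A + beta * delta * qn #|A| * E2 A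
      + \sum_(j in A) q ^+ card_above A j *
          (alpha * gamma * E1 (A :\ j) + alpha * delta * E2 (A :\ j))).
  apply: eq_big => // A; rewrite P2B => /andP[AB A0].
  rewrite /set_coef class_n1 ?(fintype.subset_trans AB) ?subsetUr //.
  rewrite cardsU1 oB /= wE //; congr (_ * _).
  have oA : (o \in A) = false.
    by apply/negbTE; apply: contra oB; apply: (fintype.subsetP AB).
  (* After the shift by [A], the positions one below [o] are exactly those of [A], since the earlier
     coordinates of [y] are at least [y_o]. *)
  have lowA : lower_set n o (y - vsum A) = A.
    apply/setP => p; rewrite inE !vE oA subr0.
    case pA: (p \in A).
      have := fintype.subsetP AB p pA; rewrite inE => /andP[-> /eqP ->].
      by rewrite eqxx.
    apply/negbTE/negP => /andP[/yo + /eqP]; rewrite subr0 => + e.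
    by rewrite e; lia.
  rewrite (G_insert T_wall T_adjacent T_comm T_braid _ (o := o)) // ?lowA; last first.
    by move=> p /yo; rewrite !vE oA subr0; case: (p \in A); lia.
  congr (_ + _); apply: eq_bigr => j jA; congr (_ * _).
  have e : y - vsum A + vbasis_elt j = y - vsum (A :\ j).
    by rewrite /vsum (big_setD1 j) //= opprD addrA addrAC subrK.
  by rewrite e.
have part3 : \sum_(A | P2 A && (A \subset B)) set_coef n y A * G n f (y - vsum A)
  = \sum_(A : {set 'I_k} | (A \subset B) && (A != set0))
      coef #|B|.-1 #|A|.-1 * q ^+ weight B A * E1 A.
  apply: eq_big => // A; rewrite P2B => /andP[AB A0].
  by rewrite /set_coef class_n // wE.
(* Level sets outside [B] lie strictly above the height of [o]: their block does not grow, and after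
   the shift [o] is still minimal. *)
have part4 : \sum_(A | P2 A && ~~ (A \subset B)) set_coef n.+1 y A * G n.+1 f (y - vsum A)
  = \sum_(A | P2 A && ~~ (A \subset B)) set_coef n y A * G n f (y - vsum A).
  apply: eq_bigr => A /andP[/and3P[/fintype.subsetP An /set0Pn[a aA] /levelP lA] AB].
  have An' p : p \in A -> (p < n)%N by move/An; rewrite inE.
  have ne p : p \in A -> y p 0 != y o 0.
    move=> pA; apply: contra AB => /eqP e; apply/fintype.subsetP => p' p'A.
    by rewrite inE An' //= (lA p' p p'A pA) e.
  have oA : (o \in A) = false by apply/negbTE/negP => /An'; rewrite ltnn.
  congr (_ * _).
    rewrite /set_coef (_ : level_class n.+1 y A = level_class n y A) //.
    apply/setP => p; rewrite !inE; have [->|po] := eqVneq p o.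
      rewrite ltnn /=; apply/negbTE/negP => /andP[_ /forall_inP/(_ a aA)].
      by rewrite eq_sym (negPf (ne a aA)).
    by rewrite -ltS po andbT.
  apply: (G_widen T_comm T_braid _ (o := o)) => // p pn.
  rewrite !vE oA subr0; have := yo p pn; case pA: (p \in A) => /=; last by lia.
  by have := ne p pA; lia.
have E10 : E1 set0 = f y.
  by rewrite /E1 vsum0 subr0 (G_chamber T_comm T_braid) // (chamber_widen _ ch) // ltnW.
have E20 : E2 set0 = f (y - vbasis_elt o).
  rewrite /E2 vsum0 subr0 (G_chamber T_comm T_braid) //.
  apply: chamber_outer (chamber_widen (ltnW nk) ch) => p pn.
  by rewrite subE -val_eqE /= ltn_eqF ?subr0.
have sumn : \sum_(A | P2 A) set_coef n y A * G n f (y - vsum A) = 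
   \sum_(A : {set 'I_k} | (A \subset B) && (A != set0))
      coef #|B|.-1 #|A|.-1 * q ^+ weight B A * E1 A
   + \sum_(A | P2 A && ~~ (A \subset B)) set_coef n y A * G n f (y - vsum A).
  by rewrite (bigID (fun A : {set 'I_k} => A \subset B)) /= part3.
have := block_identity q0 qn_neq0 B E1 E2; rewrite E10 E20 => BI.
rewrite -/(P2 _) sumn.
rewrite [X in _ = _ + X](bigID (fun A : {set 'I_k} => o \in A)) /= part1.
rewrite (eq_bigl _ _ P1o) [X in _ = _ + (_ + X)](bigID (fun A : {set 'I_k} => A \subset B)) /=.
rewrite part2 part4 mE /const_term.
apply/eqP; rewrite -subr_eq0; apply/eqP; move/eqP: BI; rewrite -subr_eq0 => /eqP BI.
apply: etrans (_ : _ = - (_ - _)) (etrans (congr1 -%R BI) (oppr0 _)).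
do 4!move: (\sum_(A : {set 'I_k} | _) _) => ?.
ring.
Qed.

Definition set_hamiltonian (f : fun_space C k) : fun_space C k := fun x =>
  - (alpha * gamma) * (\sum_(p < k) const_term (d_minus x p)) * f x
  + \sum_(A : {set 'I_k} | (A != set0) && level x A)
      set_coef k x A * f (x - vsum A).

Lemma set_hamiltonian_dominant x (f : fun_space C k) : chamber k x ->
  set_hamiltonian (G k f) x = X_hat_sum f x.
Proof.
move=> ch; transitivity (\sum_(p : 'I_k | (p < k)%N) f (x - vbasis_elt p)); last first.
  by apply: eq_bigl => p; rewrite ltn_ord.
rewrite sum_shifts_dominant // /set_hamiltonian (G_chamber T_comm T_braid) //.
congr (_ * _ * _ + _); first by apply: eq_bigl => p; rewrite ltn_ord.
apply: eq_bigl => A; rewrite (_ : A \subset below k) //.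
by apply/fintype.subsetP => p _; rewrite inE ltn_ord.
Qed.

Lemma d_minus_swap i x p : x (lft i) 0 != x (rgt i) 0 ->
  d_minus (s_ i x) (swap_pos i p) = d_minus x p.
Proof.
move=> ne; rewrite !d_minusE; apply: (@card_swap _ i) => p'.
rewrite !inE !simple_refl_entry !swap_posK andbC [RHS]andbC.
by apply: andb_id2l => /eqP e; rewrite (swap_lt ne e).
Qed.

(** The sets [A] are reindexed by their images under the transposition of [i] and [i+1]. Level sets
    and ranks correspond because the two swapped coordinates differ. *)
Lemma set_hamiltonian_swap i x (f : fun_space C k) :
  x (lft i) 0 < x (rgt i) 0 ->
  set_hamiltonian (G k f) x = set_hamiltonian (G k (T i f)) (s_ i x).
Proof.
move=> lt; have ne : x (lft i) 0 != x (rgt i) 0 by rewrite lt_eqF.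
have ik : (i.+1 < k)%N by have := ltn_ord i; lia.
have swI := inv_inj (@swap_posK k i).
rewrite /set_hamiltonian -(G_ascent T_comm T_braid) //; congr (_ * _ * _ + _).
  rewrite [RHS](reindex_inj swI); apply: eq_bigr => p _.
  by rewrite d_minus_swap.
have imK : involutive (fun A : {set 'I_k} => swap_pos i @: A).
  move=> A; rewrite -imset_comp -[RHS]imset_id; apply: eq_imset => p /=.
  exact: swap_posK.
rewrite [RHS](reindex_inj (inv_inj imK)); apply: eq_big => [A|A /andP[A0 /levelP lA]].
  rewrite -!card_gt0 card_imset //; congr (_ && _).
  apply/levelP/levelP => lA p p'.
    by move=> /imsetP[a aA ->] /imsetP[b bA ->]; rewrite !simple_refl_entry !swap_posK; apply: lA.
  move=> pA p'A; have := lA _ _ (imset_f (swap_pos i) pA) (imset_f (swap_pos i) p'A).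
  by rewrite !simple_refl_entry !swap_posK.
congr (_ * _).
  rewrite /set_coef card_imset // big_imset /=; last by move=> p p' _ _ /swI.
  under [X in _ = _ * _ ^+ X]eq_bigr => p _ do rewrite d_minus_swap //.
  congr (coef _.-1 _ * _); apply/esym/(@card_swap _ i) => p; rewrite !inE !ltn_ord /=.
  apply/forall_inP/forall_inP => H j.
    move=> jA; have := H _ (imset_f (swap_pos i) jA).
    by rewrite !simple_refl_entry !swap_posK.
  by case/imsetP => a aA ->; rewrite !simple_refl_entry !swap_posK; apply: H.
rewrite -vsum_swap -mulmxBr; apply: (G_le T_wall T_comm T_braid) => //.
(* A level set cannot contain both swapped positions, so the shift narrows the ascent by at most
   one. It may become an equality, which is why [G_le] is used. *)
rewrite !sub_vsumE; move: lt (lA (lft i) (rgt i)) ne.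
by do 2!case: (_ \in A) => //=; [move=> _ -> // /eqP|lia..].
Qed.

Lemma set_hamiltonian_propagation (f : fun_space C k) :
  (forall i (f : fun_space C k), T i (X_hat_sum f) = X_hat_sum (T i f)) ->
  set_hamiltonian (G k f) = G k (X_hat_sum f).
Proof.
move=> T_X; apply: funext => x; move: x f.
apply: (sort_ind (n := k)) => [x ch f|x i ik lt IH f].
  by rewrite set_hamiltonian_dominant // (G_chamber T_comm T_braid).
rewrite (set_hamiltonian_swap _ lt) IH ?(inversions_ascent lt) //.
by rewrite (G_ascent T_comm T_braid _ ik lt) T_X.
Qed.

End SetHamiltonian.

(** * Comparison with the definitions *)

Section TupleSums.
Variables (C : fieldType) (k : nat) (alpha beta gamma delta : C).
Implicit Types (x y : lattice k) (p : 'I_k) (A : {set 'I_k}).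

Local Notation qn := (qint alpha beta gamma delta).
Local Notation q := (hecke_q alpha beta gamma delta).

(** Within each class of equal coordinates, the ranks counted from either end take the same
    values. *)
Lemma sum_d_plus (g : nat -> C) x :
  \sum_(p < k) g (d_plus x p) = \sum_(p < k) g (d_minus x p).
Proof.
pose cl p := [set p' : 'I_k | x p' 0 == x p 0].
have clE p p' : (cl p' == cl p) = (x p' 0 == x p 0).
  apply/eqP/eqP => [/setP/(_ p')|e]; first by rewrite !inE eqxx => /esym/eqP.
  by apply/setP => a; rewrite !inE e.
rewrite (partition_big cl predT) // [RHS](partition_big cl predT) //=.
apply: eq_bigr => S _; pose D := [set p | cl p == S].
transitivity (\sum_(p in D) g (card_above D p)).
  apply: eq_big => [p|p /eqP pS]; first by rewrite inE.
  congr g; rewrite d_plusE; apply: eq_card => p'.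
  by rewrite !inE -pS clE andbC.
rewrite sum_rank_above -sum_rank_below.
apply: eq_big => [p|p]; rewrite inE // => /eqP pS.
congr g; rewrite d_minusE; apply: eq_card => p'.
by rewrite !inE -pS clE andbC.
Qed.

Lemma sorted_enum_set A : sorted ltn [seq val j | j <- enum A].
Proof.
rewrite sorted_map; apply: (@subseq_sorted _ _ _ _ (enum 'I_k)).
- by move=> a b c; apply: ltn_trans.
- by rewrite [X in subseq _ X]enumT; apply: filter_subseq.
by rewrite -sorted_map val_enum_ord; apply: iota_ltn_sorted.
Qed.

Lemma enum_sorted_seq (s : seq 'I_k) : sorted ltn [seq val j | j <- s] ->
  enum [set j in s] = s.
Proof.
move=> so; apply: (inj_map val_inj); apply: (irr_sorted_eq ltn_trans ltnn) => //.
  exact: sorted_enum_set.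
apply: eq_mem_map => p; by rewrite mem_enum inE.
Qed.

Lemma sum_sorted_tuples r (F : seq 'I_k -> C) : (0 < k)%N ->
  \sum_(J : r.-tuple 'I_k | sorted ltn [seq val j | j <- J]) F J =
  \sum_(A : {set 'I_k} | #|A| == r) F (enum A).
Proof.
(* [J0] is the default of [insubd], reached only when [enum A] does not have length [r]. *)
move=> k0; pose J0 := nseq_tuple r (Ordinal k0).
rewrite [RHS](reindex_onto (fun J : r.-tuple 'I_k => [set j in J])
  (fun A => insubd J0 (enum A))) /=; last first.
  move=> A /eqP cA; apply/setP => p; rewrite inE memtE.
  by rewrite val_insubd -cardE cA eqxx mem_enum.
apply: eq_big => [J|J so]; last by rewrite enum_sorted_seq.
apply/idP/andP => [so|[cJ /eqP e]].
  rewrite cardE enum_sorted_seq // size_tuple eqxx; split=> //.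
  by apply/eqP/val_inj; rewrite val_insubd size_tuple eqxx.
by rewrite -e val_insubd -cardE cJ sorted_enum_set.
Qed.

Lemma X_hat_foldr (J : seq 'I_k) (f : fun_space C k) x :
  foldr (fun j X => X_hat j \o X) id J f x = f (x - \sum_(j <- J) vbasis_elt j).
Proof.
elim: J x => [|j J IH] x /=; first by rewrite big_nil subr0.
by rewrite /X_hat IH big_cons opprD addrA.
Qed.

Lemma same_coordsE x A : same_coords x (enum A) = level x A.
Proof.
have E p : pair_form (dual_elt p) x = x p 0 by rewrite /pair_form -rowE mxE.
rewrite /same_coords; apply/idP/levelP => [co p p' pA p'A|le].
  have mem_ a : a \in A -> x a 0 \in [seq pair_form (dual_elt j) x | j <- enum A].
    by move=> aA; apply/mapP; exists a; rewrite ?mem_enum ?E.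
  case: (map _ _) co (mem_ p pA) (mem_ p' p'A) => //= b s /allP co.
  by rewrite !inE => /predU1P[->|/co/eqP ->] /predU1P[->|/co/eqP ->].
have : all (fun a => a \in A) (enum A) by apply/allP => a; rewrite mem_enum.
case: (enum A) => //= a s /andP[aA /allP sA]; apply/allP => b /mapP[c cs ->] /=.
by rewrite !E; apply/eqP/le => //; apply: sA.
Qed.

Lemma d_plus_minus x A p : level x A -> p \in A ->
  (d_plus x p + d_minus x p)%N = #|level_class k x A|.-1.
Proof.
move=> /levelP le pA; rewrite d_plusE d_minusE.
have -> : level_class k x A = [set p' : 'I_k | x p' 0 == x p 0].
  apply/setP => a; rewrite !inE ltn_ord /=.
  by apply/forall_inP/eqP => [/(_ p pA)/eqP //|e j jA]; rewrite e (le p j).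
rewrite [in RHS](cardsD1 p) inE eqxx add1n /=.
rewrite -[in RHS](cardsID [set p' : 'I_k | (p < p')%N]); congr (_ + _)%N; apply: eq_card => a.
  by rewrite !inE; have [->|ap] := eqVneq a p; rewrite ?ltnn //= andbC.
rewrite !inE -leqNgt; have [->|ap] := eqVneq a p; first by rewrite ltnn andbF.
by rewrite ltn_neqAle val_eqE ap.
Qed.

Lemma hamiltonianE (f : fun_space C k) : (0 < k)%N ->
  hamiltonian alpha beta gamma delta f = set_hamiltonian alpha beta gamma delta f.
Proof.
move=> k0; apply: funext => x; rewrite /hamiltonian /set_hamiltonian /ham_const.
congr (_ * _ * _ + _).
  exact: (sum_d_plus (const_term alpha beta gamma delta)).
pose F (r : nat) A := set_coef alpha beta gamma delta k x A * f (x - vsum A).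
transitivity (\sum_(r < k) \sum_(A : {set 'I_k} | (#|A| == r.+1) && level x A) F r A).
  apply: eq_bigr => r _.
  pose H (J : seq 'I_k) := (if same_coords x J then
    q ^+ (\sum_(j <- J) d_minus x j)%N / \prod_(p < r.+1)
      (1 + beta * gamma * qn (d_plus x (head (Ordinal k0) J)
         + d_minus x (head (Ordinal k0) J) - p)%N) else 0)
    * f (x - \sum_(j <- J) vbasis_elt j).
  transitivity ((- (beta * delta)) ^+ r * qfact alpha beta gamma delta r
     / q ^+ (r.+1 * r)./2 * \sum_(A : {set 'I_k} | #|A| == r.+1) H (enum A)).
    rewrite -sum_sorted_tuples //; congr (_ * _); apply: eq_bigr => J _.
    rewrite X_hat_foldr /ham_coef /H.
    by have -> : thead J = head (Ordinal k0) J by case/tupleP: J => a J.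
  rewrite mulr_sumr big_mkcondr /=; apply: eq_bigr => A /eqP cA.
  rewrite /H same_coordsE; case: ifP => lA; last by rewrite mul0r mulr0.
  have hA : head (Ordinal k0) (enum A) \in A.
    rewrite -mem_enum; have : (0 < size (enum A))%N by rewrite -cardE cA.
    by case: (enum A) => //= a s _; rewrite mem_head.
  rewrite /F /set_coef /block_coef cA /= !big_enum /= (d_plus_minus lA hA) -/(vsum A).
  move: (f _) (q ^+ _) (q ^+ _) (\prod_(_ < _) _) => a b c d.
  by rewrite !mulrA; congr (_ * _); rewrite -!mulrA; do 3!congr (_ * _); rewrite mulrC.
(* Each nonempty level set [A] occurs for the single index [r = #|A|.-1]. *)
rewrite (exchange_big_dep (fun A => (A != set0) && level x A)) /=; last first.
  by move=> r A _ /andP[/eqP cA ->]; rewrite -card_gt0 cA.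
apply: eq_bigr => A /andP[A0 lA].
have rk : (#|A|.-1 < k)%N.
  rewrite prednK ?card_gt0 //; apply: leq_trans (max_card _) _; by rewrite card_ord.
rewrite (big_pred1 (Ordinal rk)) // => r; rewrite lA andbT.
by rewrite [RHS]/= -val_eqE /=; move: A0; rewrite -card_gt0; case: #|A| => // m _;
  rewrite eqSS eq_sym.
Qed.

End TupleSums.

(** * Sorting elements of the Weyl group and their reduced words *)

Section SortingElements.
Variable k : nat.
Implicit Types (x : lattice k) (w : 'M[int]_k) (s : seq 'I_k.-1).

Lemma run_rcons (u : seq 'I_k.-1) i x :
  run (rcons u i) x = simple_refl i *m run u x.
Proof. by elim: u x => [|j u IH] x //=. Qed.

Lemma word_prod_run s x : word_prod s *m x = run (rev s) x.
Proof.
elim: s => [|i s IH] /=; first by rewrite mul1mx.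
by rewrite rev_cons run_rcons -IH mulmxA.
Qed.

Lemma in_closed_chamberE x : in_closed_chamber x <-> chamber k x.
Proof.
split=> [ch|/forallP ch i]; last first.
  have := ch i; rewrite alpha_rootE subr_ge0 => /implyP; apply.
  by have := ltn_ord i; lia.
by apply/forallP => i; apply/implyP => _; rewrite -subr_ge0 -alpha_rootE; apply: ch.
Qed.

Lemma minimal_nat (P : nat -> Prop) : (exists n, P n) ->
  exists2 n, P n & forall m, P m -> (n <= m)%N.
Proof.
move=> exP; have exb : exists n, `[< P n >] by case: exP => n /asboolP; exists n.
by case: (ex_minnP exb) => n /asboolP Pn nP; exists n => // m /asboolP/nP.
Qed.

Lemma weyl_lengthP w : weyl_group w -> is_length w (weyl_length w).
Proof.
case=> s0 s0P; rewrite /weyl_length; case: xgetP => // none.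
have [|n nP nmin] := @minimal_nat (fun n => exists2 s, word_prod s = w & size s = n).
  by exists (size s0), s0.
by case: (none n); split=> // s sw; apply: nmin; exists s.
Qed.

Lemma sorting_eltP x : is_sorting_elt x (sorting_elt x).
Proof.
rewrite /sorting_elt; case: xgetP => // none.
pose P w := weyl_group w /\ in_closed_chamber (w *m x).
have [|n [w [wW wC] wn] nmin] :=
    @minimal_nat (fun n => exists2 w, P w & weyl_length w = n).
  have [u su] := sorts_exists k x; exists (weyl_length (word_prod (rev u))).
  exists (word_prod (rev u)) => //; split; first by exists (rev u).
  by apply/in_closed_chamberE; rewrite word_prod_run revK; apply: run_chamber su.
case: (none w); split=> // w' w'W w'C; rewrite wn; apply: nmin.
by exists w'.
Qed.

(** A greedy sorting word has as many letters as [x] has inversions, which bounds the minimal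
    length; a reduced word of the sorting element is thus short enough for [sorts_run]. *)
Lemma sorting_elt_word x s : reduced_expression (sorting_elt x) s ->
  sorts k x (rev s).
Proof.
case=> sw sl; have [wW wC wmin] := sorting_eltP x.
apply: sorts_run.
  by rewrite -word_prod_run sw; apply/in_closed_chamberE.
rewrite size_rev sl; have [u su] := sorts_exists k x.
have uW : weyl_group (word_prod (rev u)) by exists (rev u).
apply: leq_trans (wmin _ uW _) _.
  by apply/in_closed_chamberE; rewrite word_prod_run revK; apply: run_chamber su.
by rewrite -(size_sorts su) -(size_rev u); apply: (weyl_lengthP uW).2.
Qed.

End SortingElements.

(** * Propagation operator and intertwining identity *)

Section PropagationOperator.
Variables (C : fieldType) (k : nat) (alpha beta gamma delta : C).
Hypothesis C0 : [pchar C] =i pred0.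

Local Notation T := (@T_hat C k alpha beta gamma delta).

Let T_comm := @T_hat_comm C k alpha beta gamma delta C0.
Let T_braid := @T_hat_braid C k alpha beta gamma delta C0.

Lemma T_word_rcons (u : seq 'I_k.-1) i (f : fun_space C k) :
  T_word T (rcons u i) f = T i (T_word T u f).
Proof. by elim: u f => [|j u IH] f //=. Qed.

(** The reduced word chosen in [T_hat_elt], read backwards, is a sorting word; the value then does
    not depend on the choice. *)
Lemma propagationE (f : fun_space C k) :
  propagation alpha beta gamma delta f = partial_propagation T k f.
Proof.
apply: funext => x; rewrite /propagation /T_hat_elt.
have [wW _ _] := sorting_eltP x; have [[s sw sl] _] := weyl_lengthP wW.
case: xgetP => [r _ rP|/(_ s)[]//]; have [rw _] := rP.
rewrite (partial_propagationE T_comm T_braid f (sorting_elt_word rP)).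
rewrite -rw word_prod_run; move: (run _ _) => y.
congr (_ y); elim: r {rP rw} => [|i r IH] //=.
by rewrite IH rev_cons T_word_rcons.
Qed.

Lemma propagation_scale (a : C) (f : fun_space C k) :
  propagation alpha beta gamma delta (fun x => a * f x)
  = (fun x => a * propagation alpha beta gamma delta f x).
Proof.
apply: funext => x; rewrite /propagation /T_hat_elt.
suff -> s : foldr (fun i S => T i \o S) id s (fun x => a * f x)
  = (fun x => a * foldr (fun i S => T i \o S) id s f x) by [].
by elim: s => [|i s IH] //=; rewrite IH T_hat_scale.
Qed.

Lemma hamiltonian_propagation (f : fun_space C k) : (0 < k)%N ->
  hecke_q alpha beta gamma delta != 0 ->
  (forall n : nat, (0 < n)%N ->
     1 + beta * gamma * qint alpha beta gamma delta n != 0) ->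
  hamiltonian alpha beta gamma delta (propagation alpha beta gamma delta f)
  = propagation alpha beta gamma delta (X_hat_sum f).
Proof.
move=> k0 q0 qn_neq0; rewrite hamiltonianE // !propagationE.
apply: (set_hamiltonian_propagation _ _ T_comm T_braid q0 qn_neq0).
- exact: T_hat_wall C0.
- exact: T_hat_adjacent C0.
- exact: T_hat_X_sum C0.
Qed.

End PropagationOperator.

Theorem theorem3p11 (R : realType) (k : nat) (alpha beta gamma delta : R[i])
    (hk : (2 <= k)%N)
    (hq : hecke_q alpha beta gamma delta != 0)
    (hn : forall n : nat, (0 < n)%N ->
       1 + beta * gamma * qint alpha beta gamma delta n != 0) :
  @hamiltonian R[i] k alpha beta gamma delta \o
      @propagation R[i] k alpha beta gamma delta
    = @propagation R[i] k alpha beta gamma delta \o @X_hat_sum R[i] k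
  /\
  (forall (f : fun_space R[i] k) (lambda : R[i]),
     X_hat_sum f = (fun x => lambda * f x) ->
     hamiltonian alpha beta gamma delta (propagation alpha beta gamma delta f)
       = (fun x => lambda * propagation alpha beta gamma delta f x)).
Proof.
have HG f := hamiltonian_propagation (pchar_num _) f (ltnW hk) hq hn.
split=> [|f lambda eig]; first by apply: funext => f /=; apply: HG.
by rewrite HG eig propagation_scale.
Qed.
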